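(* Let $\alpha\in(0,1)$, let $M$ be a differentiable manifold of dimension $n$, let $L=L(t,x,y^{(\alpha)})\in C^\infty(J^\alpha(\mathbb{R},M))$ be a fractional Lagrange function, let $F=F(x,y^{(\alpha)})\in C^\infty(J^\alpha(\mathbb{R},M))$, let $\lambda=\lambda(t)$ be a Lagrange multiplier, and let $$L_2(t,\lambda,x,y^{(\alpha)})=L(t,x,y^{(\alpha)})+\lambda F(x,y^{(\alpha)}).$$ (a) The fractional Euler–Lagrange equations of $L_2$ are $$D^\alpha_{x^i}L+\lambda D^\alpha_{x^i}F-d_t^{2\alpha}(D^\alpha_{y^{i(\alpha)}}L)-\lambda y^{j(\alpha)}D^\alpha_{x^j}(D^\alpha_{y^{i(\alpha)}}F)-\lambda y^{j(2\alpha)}D^\alpha_{y^{j(\alpha)}}(D^\alpha_{y^{i(\alpha)}}F)-D_t^\alpha\lambda\,D^\alpha_{y^{i(\alpha)}}F=0,\qquad i=1,\dots,n.$$ (b) If $L(t,x,y^{(\alpha)})=L_1(x,y^{(\alpha)})E_\alpha(-\rho t^\alpha)$ with $\rho>0$, then the equations in (a) become $$E_\alpha(-\rho t^\alpha)\Big(D^\alpha_{x^i}L_1+\rho D^\alpha_{y^{i(\alpha)}}L_1-y^{j(\alpha)}D^\alpha_{x^j}(D^\alpha_{y^{i(\alpha)}}L_1)-y^{j(2\alpha)}D^\alpha_{y^{j(\alpha)}}(D^\alpha_{y^{i(\alpha)}}L_1)\Big)$$ $$+\lambda\Big(D^\alpha_{x^i}F-y^{j(\alpha)}D^\alpha_{x^j}(D^\alpha_{y^{i(\alpha)}}F)-y^{j(2\alpha)}D^\alpha_{y^{j(\alpha)}}(D^\alpha_{y^{i(\alpha)}}F)\Big)-D_t^\alpha\lambda\,D^\alpha_{y^{i(\alpha)}}F=0,\qquad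 i=1,\dots,n.$$
   Context: Summation over the repeated index $j\in\{1,\dots,n\}$ is understood. Caputo derivative: for $\beta\ge 0$ and $m\in\mathbb{N}^*$ with $m-1<\beta<m$, $D_t^\beta x(t)=\frac{1}{\Gamma(m-\beta)}\int_0^t\frac{x^{(m)}(s)}{(t-s)^{\beta+1-m}}ds$. For a function $f$ of several variables, the partial Caputo derivative of order $\alpha\in(0,1)$ in the variable $z^i$ is $D^\alpha_{z^i}f(z)=\frac{1}{\Gamma(1-\alpha)}\int_{a^i}^{z^i}\frac{\partial f}{\partial z^i}(z^1,\dots,z^{i-1},s,z^{i+1},\dots)\frac{ds}{(z^i-s)^\alpha}$, with fixed base points $a^i$ (base point $0$ in the variable $t$). $E_\alpha(z)=\sum_{k=0}^\infty\frac{z^k}{\Gamma(1+\alpha k)}$ is the Mittag-Leffler function, so that $D_t^\alpha E_\alpha(-\rho t^\alpha)=-\rho E_\alpha(-\rho t^\alpha)$; $\rho$ is the discount rate. $J^\alpha(\mathbb{R},M)=\mathbb{R}\times Osc^\alpha(M)$ is the fractional jet bundle, where $Osc^\alpha(M)$ is the set of equivalence classes of curves $c$ in $M$, two curves through $x_0$ at time $0$ being equivalent if $D_t^\alpha(f\circ c)|_{t=0}$ agrees for all smooth $f$ on a chart around $x_0$. Local coordinates are $(t,x^i,y^{i(\alpha)})$, $i=1,\dots,n$. Along a curve $x(t)$, $y^{i(\alpha)}=\frac{1}{\Gamma(1+\alpha)}D_t^\alpha x^i$ and $y^{i(2\alpha)}=\frac{1}{\Gamma(1+2\alpha)}D_t^{2\alpha}x^i$.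 The fractional Euler–Lagrange equations of a fractional Lagrange function $L(t,x,y^{(\alpha)})$ are $D^\alpha_{x^i}L-d_t^{2\alpha}(D^\alpha_{y^{i(\alpha)}}L)=0$, $i=1,\dots,n$, where $d_t^{2\alpha}=D_t^\alpha+y^{j(\alpha)}D^\alpha_{x^j}+y^{j(2\alpha)}D^\alpha_{y^{j(\alpha)}}$. For $L_2$ they are taken with $\lambda=\lambda(t)$ regarded as a function of $t$. (The fractional Euler–Lagrange equations of $L$ on the restriction $F(x,y^{(\alpha)})=0$ are by definition those of $L_2$.) *)

(* Defs.v *)
From HB Require Import structures.
From mathcomp Require Export all_boot all_order all_algebra.
From mathcomp Require Export all_classical all_reals all_analysis.
Export Order.TTheory GRing.Theory Num.Theory numFieldNormedType.Exports.

#[export] Set Implicit Arguments.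
#[export] Unset Strict Implicit.
#[export] Unset Printing Implicit Defensive.

Local Open Scope classical_set_scope.
Local Open Scope ring_scope.

Section Caputo.
Variable R : realType.
Implicit Types (f : R -> R) (a z : R).

Definition Gamma (p : R) : R :=
  \int[@lebesgue_measure R]_(u in `]0, +oo[) (u `^ (p - 1) * expR (- u)).

(* Caputo derivative of order b >= 0 with base point a, at z >= a. For
   m - 1 < b < m one has m = truncn b + 1. The integral formula does not cover
   integer orders, where the ordinary derivative is used instead; this is
   needed for the order 2 * alpha when alpha = 1/2. *)
Definition caputo (b : R) a f z : R :=
  let m := (Num.truncn b).+1 in
  if b == (Num.truncn b)%:R then derive1n (Num.truncn b) f z
  else (Gamma (m%:R - b))^-1 *
       \int[@lebesgue_measure R]_(s in `]a, z[)
          (derive1n m f s / (z - s) `^ (b + 1 - m%:R)).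

(* For 0 < alpha < 1: the integral in [caputo alpha a f z] makes sense. *)
Definition caputo_derivable (alpha : R) a f z : Prop :=
  [/\ {within `[a, z], continuous f},
      forall s, a < s < z -> derivable f s 1 &
      (@lebesgue_measure R).-integrable `]a, z[
        (EFin \o (fun s => derive1 f s / (z - s) `^ alpha))].

(* The value at t = 0 is the right limit: the integral itself runs over an
   empty interval at t = 0. *)
Definition caputo_at0 (alpha : R) f (l : R) : Prop :=
  (\forall t \near 0^'+, caputo_derivable alpha 0 f t) /\
  caputo alpha 0 f t @[t --> 0^'+] --> l.

Definition mittag_leffler (alpha z : R) : R :=
  limn (series (fun k => z ^+ k / Gamma (1 + alpha * k%:R))).

End Caputo.

Section Smooth.
Variables (R : realType) (m : nat).
Implicit Types (U : set 'rV[R]_m) (f : 'rV[R]_m -> R) (z : 'rV[R]_m).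

Definition upd z (i : 'I_m) (s : R) : 'rV[R]_m :=
  \row_j (if j == i then s else z 0 j).

Definition partial (i : 'I_m) f z : R := derive1 (fun s => f (upd z i s)) (z 0 i).

Fixpoint Ck (k : nat) U f : Prop :=
  (forall z, U z -> {for z, continuous f}) /\
  if k is k'.+1 then
    forall i, (forall z, U z -> derivable (fun s => f (upd z i s)) (z 0 i) 1)
              /\ Ck k' U (partial i f)
  else True.

(* Meant for open U. *)
Definition smooth U f : Prop := forall k, Ck k U f.

End Smooth.

Section Manifold.
Variables (R : realType) (n : nat) (M : topologicalType).

Record chart := Chart {
  dom : set M ;
  coord : M -> 'rV[R]_n ;
  coordV : 'rV[R]_n -> M }.

Definition cod (phi : chart) : set 'rV[R]_n := coord phi @` dom phi.

Definition is_chart (phi : chart) : Prop :=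
  [/\ open (dom phi) /\ open (cod phi),
      forall p, dom phi p -> coordV phi (coord phi p) = p,
      {within dom phi, continuous (coord phi)} &
      {within cod phi, continuous (coordV phi)}].

Definition compatible (phi psi : chart) : Prop :=
  forall i, smooth (coord phi @` (dom phi `&` dom psi))
                   (fun z => coord psi (coordV phi z) 0 i).

Definition is_manifold (A : set chart) : Prop :=
  [/\ hausdorff_space M,
      @second_countable M,
      (forall phi, A phi -> is_chart phi),
      (forall p, exists2 phi, A phi & dom phi p) &
      (forall phi psi, A phi -> A psi -> compatible phi psi)].

End Manifold.

Section Jet.
Variables (R : realType) (n : nat) (M : topologicalType).
Variables (A : set (chart R n M)) (alpha : R).

(* Only the germ at 0+ of a curve matters, and its regularity is enforced by
   the existence of the derivatives in [caputo_at0]. *)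
Definition osc_equiv (c c' : R -> M) : Prop :=
  c 0 = c' 0 /\
  forall phi (f : M -> R), A phi -> dom phi (c 0) ->
    smooth (cod phi) (f \o coordV phi) ->
    forall l, caputo_at0 alpha (f \o c) l <-> caputo_at0 alpha (f \o c') l.

Definition osc_class (c : R -> M) : set (R -> M) := [set c' | osc_equiv c c'].

Definition Osc : Type := {C : set (R -> M) | exists c, C = osc_class c}.

Definition osc_of (c : R -> M) : Osc := exist _ (osc_class c) (ex_intro _ c erefl).

Definition Jet : Type := (R * Osc)%type.

(* The point with coordinates (x, y) in the chart phi: the class of
   s |-> phi^-1 (x + s^alpha y), whose coordinates have the constant Caputo
   derivative Gamma (1 + alpha) y. *)
Definition osc_pt (phi : chart R n M) (x y : 'rV[R]_n) : Osc :=
  osc_of (fun s => coordV phi (x + s `^ alpha *: y)).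

Definition loc (phi : chart R n M) (G : Jet -> R) (t : R) (x y : 'rV[R]_n) : R :=
  G (t, osc_pt phi x y).

(* Smoothness in the coordinates (t, x, y), stacked in a single row. *)
Definition smooth_jet (G : Jet -> R) : Prop :=
  forall phi, A phi ->
  smooth [set z : 'rV[R]_(1 + (n + n)) | cod phi (lsubmx (rsubmx z))]
         (fun z => loc phi G (lsubmx z 0 0) (lsubmx (rsubmx z)) (rsubmx (rsubmx z))).

Definition L2 (L : Jet -> R) (F : Osc -> R) (t lam : R) (u : Osc) : R :=
  L (t, u) + lam * F u.

End Jet.

Section EulerLagrange.
Variables (R : realType) (n : nat) (alpha : R).
(* base points for the variables x and y *)
Variables (a b : 'rV[R]_n).
Implicit Types (g : R -> 'rV[R]_n -> 'rV[R]_n -> R) (x y : 'rV[R]_n).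

Definition Dt g t x y : R := caputo alpha 0 (fun s => g s x y) t.
Definition Dx (i : 'I_n) g t x y : R :=
  caputo alpha (a 0 i) (fun s => g t (upd x i s) y) (x 0 i).
Definition Dy (i : 'I_n) g t x y : R :=
  caputo alpha (b 0 i) (fun s => g t x (upd y i s)) (y 0 i).

Definition dt2 g t x y (y2 : 'rV[R]_n) : R :=
  Dt g t x y + \sum_j y 0 j * Dx j g t x y + \sum_j y2 0 j * Dy j g t x y.

Definition EL g (i : 'I_n) t x y (y2 : 'rV[R]_n) : R := Dx i g t x y - dt2 (Dy i g) t x y y2.

End EulerLagrange.

Section Equations.
Variables (R : realType) (n : nat) (M : topologicalType) (alpha : R).
Variables (a b : 'rV[R]_n) (phi : chart R n M).

(* Points at which all the partial Caputo derivatives, first and iterated,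
   make sense: they lie above the base points, and the segments over which one
   integrates stay in the chart. *)
Definition admissible (t : R) (x y : 'rV[R]_n) : Prop :=
  [/\ 0 < t, cod phi x,
      forall i, a 0 i <= x 0 i /\
                forall s, a 0 i <= s <= x 0 i -> cod phi (upd x i s) &
      forall i, b 0 i <= y 0 i].

(* The coordinates y^(k alpha) along a curve. *)
Definition ycurve (k : nat) (c : R -> M) (t : R) : 'rV[R]_n :=
  \row_i ((Gamma (1 + k%:R * alpha))^-1 *
          caputo (k%:R * alpha) 0 (fun s => coord phi (c s) 0 i) t).

Definition solves (E : 'I_n -> R -> 'rV[R]_n -> 'rV[R]_n -> 'rV[R]_n -> R)
    (c : R -> M) (T : R) : Prop :=
  forall i t, 0 < t <= T ->
  E i t (coord phi (c t)) (ycurve 1 c t) (ycurve 2 c t) = 0.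

(* The systems E_i = 0 and E'_i = 0 coincide: as functions of the independent
   coordinates (t, x, y^(alpha), y^(2 alpha)), and along curves. *)
Definition same_equations
    (E E' : 'I_n -> R -> 'rV[R]_n -> 'rV[R]_n -> 'rV[R]_n -> R) : Prop :=
  (forall i t x y y2, admissible t x y -> E i t x y y2 = E' i t x y y2) /\
  (forall (c : R -> M) (T : R),
     (forall t, 0 <= t <= T -> dom phi (c t)) ->
     (forall t, 0 < t <= T -> admissible t (coord phi (c t)) (ycurve 1 c t)) ->
     solves E c T <-> solves E' c T).

End Equations.

(* Main.v *)
Require Import Defs.
From mathcomp Require Import measurable_realfun lebesgue_integral_under ring.

Local Open Scope classical_set_scope.
Local Open Scope ring_scope.

(** The Caputo derivative is linear, and in x and y it commutes with factors
   that depend on time alone, such as lambda. Hence the Euler-Lagrange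
   expression of L + lambda F is that of L plus

     lambda (Dx F - sum y Dx Dy F - sum y2 Dy Dy F) - (D_t lambda) Dy F,

   which is (a); see EL_add and EL_mul. If L = L1 E with E the discount factor
   E_alpha (- rho t^alpha), EL_mul applies to L itself, and (b) follows from
   D_t E = - rho E. Both identities hold pointwise at admissible arguments,
   hence also along curves (same_equations_ext).

   Linearity is not free: an integral is additive only on integrable functions,
   so every Caputo derivative in these expressions, first or iterated, must be
   shown to exist. The criterion is has_caputo_bound: f'(s) may blow up at the
   base point c like a power (s - c)^(r - 1) with r > 0, since multiplied by
   (z - s)^(- alpha) this is still a beta kernel. For first derivatives of
   smooth functions it holds with r = 1 (has_caputo_smooth). For an iterated
   derivative, the inner one is an integral from e to v against
   (v - u)^(- alpha), where u is replaced by e + (v - e) w with w in ]0, 1[: it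
   becomes (v - e)^(1 - alpha) times an integral with a fixed weight and a
   smooth bounded integrand (caputo_rescaled). Differentiation under the
   integral sign gives r = 1 if the outer variable is another one
   (has_caputo_iterated_other), and r = 1 - alpha, from the power in front, if
   it is the same (has_caputo_iterated_same).

   For D_t E = - rho E (caputo_mittag_leffler) the series of E is differentiated
   term by term. The beta integral B(p, q) = Gamma(p) Gamma(q) / Gamma(p + q),
   obtained from Tonelli applied to Gamma(p) Gamma(q) (egammaM), and the
   recursion Gamma(p + 1) = p Gamma(p) send the k-th term to - rho times the
   preceding one; dominated convergence exchanges sum and integral. All series
   involved converge everywhere because Gamma(1 + alpha k) outgrows every
   geometric sequence (entire_ml_coef). *)

(** * Affine changes of variables *)

Section affine.
Variable R : realType.
Notation mu := (@lebesgue_measure R).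

Lemma preimage_affine_itv (c d : R) (i j : R) (x y : bool) : 0 < c ->
  (fun u => c * u + d) @^-1` [set` Interval (BSide x i) (BSide y j)] =
  [set` Interval (BSide x ((i - d) / c)) (BSide y ((j - d) / c))].
Proof.
move=> c0; apply/seteqP; split=> u /=; rewrite !in_itv/=;
  case: x; case: y => /=;
  by rewrite ?ler_pdivrMr ?ler_pdivlMr ?ltr_pdivlMr ?ltr_pdivrMr//
    ?lerBlDr ?ltrBlDr ?lerBrDr ?ltrBrDr (mulrC u).
Qed.

Lemma measurable_affine (c d : R) :
  measurable_fun [set: R] (fun u : R => c * u + d).
Proof. by apply: measurable_funD => //; exact: measurable_funM. Qed.

(** Lebesgue measure is determined by its values on intervals, hence equal to
   c times its image under w |-> c w + d. *)
Lemma ge0_integral_affine (c d : R) (D : set R) (f : R -> \bar R) : 0 < c ->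
  measurable D -> measurable_fun D f -> (forall u, D u -> 0 <= f u)%E ->
  (\int[mu]_(u in D) f u =
   c%:E * \int[mu]_(w in (fun w => c * w + d)%R @^-1` D) f (c * w + d)%R)%E.
Proof.
move=> c0 mD mf f0.
pose phi : measurableTypeR R -> measurableTypeR R := fun w => c * w + d.
have mphi : measurable_fun setT phi by exact: measurable_affine.
have H := @ge0_integral_pushforward _ _ _ _ R phi mphi mu D f mD mf.
have {}H := H (fun y yD => f0 y (set_mem yD)).
rewrite -[X in (_ * X)%E]H.
have c0' : 0 <= c by exact: ltW.
pose pm : {measure set (measurableTypeR R) -> \bar R} :=
  measure_function_pushforward__canonical__measure_function_Measure mu mphi.
have := @ge0_integral_mscale _ _ _ pm _ mD (NngNum c0') _ mf f0.
rewrite -[(NngNum c0')%:num]/c => <-.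
apply: eq_measure_integral => /= A mA _.
apply: lebesgue_measure_unique mA => _ [[i j]] _ <-.
rewrite /mscale/= /pushforward/=.
transitivity (c%:E * mu `]((i - d) / c)%R, ((j - d) / c)%R])%E; last first.
  by congr (_ * mu _)%E; exact/esym/preimage_affine_itv.
rewrite [in LHS]lebesgue_measure_itv [in RHS]lebesgue_measure_itv /=.
rewrite !lte_fin ltr_pM2r ?invr_gt0// ltrD2r.
case: ifPn => _; last by rewrite mule0.
rewrite -!EFinD -EFinM; congr EFin; field; exact/lt0r_neq0.
Qed.

Lemma Rintegral_affine (c d : R) (D : set R) (f : R -> R) : 0 < c ->
  @measurable _ (measurableTypeR R) D -> mu.-integrable D (EFin \o f) ->
  \int[mu]_(u in D) f u =
  c * \int[mu]_(w in (fun w => c * w + d) @^-1` D) f (c * w + d).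
Proof.
move=> c0 mD intf.
have mf : measurable_fun D (EFin \o f) by case/integrableP: intf.
have pos := ge0_integral_affine d c0 mD (measurable_funepos mf)
  (fun u _ => funepos_ge0 _ u).
have neg := ge0_integral_affine d c0 mD (measurable_funeneg mf)
  (fun u _ => funeneg_ge0 _ u).
have fpos := integral_funepos_lt_pinfty mD intf.
have fneg := integral_funeneg_lt_pinfty mD intf.
set D' := (fun w => c * w + d) @^-1` D.
have fin (h : R -> \bar R) : (forall u, 0 <= h u)%E ->
    (c%:E * \int[mu]_(w in D') h (c * w + d)%R < +oo)%E ->
    (\int[mu]_(w in D') h (c * w + d)%R)%E \is a fin_num.
  move=> h0; have I0 : (0 <= \int[mu]_(w in D') h (c * w + d)%R)%E.
    by apply: integral_ge0 => w _; exact: h0.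
  rewrite ge0_fin_numE// !ltey => /eqP H; apply/eqP => E; apply: H.
  by rewrite E gt0_muley// lte_fin.
have finP := fin _ (funepos_ge0 (EFin \o f))
  (eq_ind _ (fun x => x < +oo)%E fpos _ pos).
have finN := fin _ (funeneg_ge0 (EFin \o f))
  (eq_ind _ (fun x => x < +oo)%E fneg _ neg).
set P := (\int[mu]_(w in D') (EFin \o f)^\+ (c * w + d)%R)%E in pos finP.
set N := (\int[mu]_(w in D') (EFin \o f)^\- (c * w + d)%R)%E in neg finN.
have e1 : (\int[mu]_(u in D) (f u)%:E = c%:E * P - c%:E * N)%E.
  by rewrite [LHS]integralE -pos -neg.
have e2 : (\int[mu]_(w in D') (f (c * w + d)%R)%:E = P - N)%E.
  rewrite [LHS]integralE; congr (_ - _)%E; apply: eq_integral => w _.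
    by rewrite !funeposE.
  by rewrite !funenegE.
rewrite /Rintegral e1 e2 -(fineK finP) -(fineK finN).
by rewrite -!EFinM -!EFinB /= mulrBr.
Qed.

End affine.

(** * The gamma and beta integrals *)

Section gamma_beta.
Variable R : realType.
Notation mu := (@lebesgue_measure R).

(** The improper integral is the increasing limit of integrals over
   [k^-1, 1], where the fundamental theorem of calculus applies. *)
Lemma integral_powR01 (p : R) : 0 < p ->
  (\int[mu]_(u in `]0%R, 1%R[) (u `^ (p - 1))%:E = (p^-1)%:E)%E.
Proof.
move=> p0.
(* Half-open at 1, so that F 0 is the empty interval. *)
pose F (k : nat) : set R := `[k.+1%:R^-1, 1[%classic.
have FU : \bigcup_k F k = `]0, 1[%classic.
  apply/seteqP; split=> u.
    move=> [k _]; rewrite /F/= !in_itv/= => /andP[ku ->]; rewrite andbT.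
    by rewrite (lt_le_trans _ ku)// invr_gt0.
  rewrite /= in_itv/= => /andP[u0 u1].
  exists (Num.truncn u^-1) => //; rewrite /F/= in_itv/= u1 andbT.
  rewrite invf_ple ?posrE//.
  by rewrite ltW// truncnS_gt.
rewrite -FU.
have mf (D : set R) : measurable_fun D (fun u : R => (u `^ (p - 1))%:E).
  by apply/measurable_EFinP/measurable_funTS; exact: measurable_powR.
have h : (\int[mu]_(u in F k) (u `^ (p - 1))%:E @[k --> \oo] -->
   \int[mu]_(u in \bigcup_k F k) (u `^ (p - 1))%:E)%E.
  apply: ge0_nondecreasing_set_cvg_integral => //.
  - move=> k l kl; apply/subsetPset => u; rewrite /F/= !in_itv/= => /andP[ku ->].
    by rewrite andbT (le_trans _ ku)// lef_pV2 ?posrE// ler_nat.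
  - by move=> i; exact: measurable_itv.
  - by move=> i; exact: mf.
  - by move=> i u _; rewrite lee_fin powR_ge0.
rewrite -(cvg_lim _ h)//; apply/cvg_lim => //.
have dG (u : R) : 0 < u -> is_derive u 1 (fun u => p^-1 * u `^ p) (u `^ (p - 1)).
  move=> u0; have D := is_deriveZ p^-1 (is_derive1_powR p u0).
  apply: (is_derive_eq D).
  by rewrite /GRing.scale/=; field; exact/lt0r_neq0.
have cG (u : R) : 0 < u -> {for u, continuous (fun u => p^-1 * u `^ p)}.
  by move=> u0; apply/differentiable_continuous/derivable1_diffP; case: (dG u u0).
have cf (u : R) : 0 < u -> {for u, continuous (fun u : R => u `^ (p - 1))}.
  move=> u0; apply/differentiable_continuous/derivable1_diffP.
  by apply: derivable_powR; rewrite in_itv/= u0.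
have Fk k : (\int[mu]_(u in F k) (u `^ (p - 1))%:E = 
  (p^-1 - p^-1 * k.+1%:R^-1 `^ p)%:E)%E.
  have [->|k0] := eqVneq k 0%N.
    by rewrite /F invr1 set_itvco0 integral_set0 powR1 mulr1 subrr.
  have k1 : k.+1%:R^-1 < 1 :> R by rewrite invf_lt1// ltr1n ltnS lt0n.
  rewrite /F integral_itv_bndo_bndc; last exact: mf.
  rewrite (@continuous_FTC2 _ _ (fun u => p^-1 * u `^ p))//.
  - by rewrite powR1 mulr1 EFinB.
  - apply: continuous_in_subspaceT => u; rewrite inE/= in_itv/= => /andP[ku _].
    by apply: cf; rewrite (lt_le_trans _ ku)// invr_gt0.
  - split.
    + move=> u; rewrite in_itv/= => /andP[ku _].
      by have [] := dG u (lt_trans _ ku); rewrite ?invr_gt0.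
    + by apply: cvg_at_right_filter; apply: cG; rewrite invr_gt0.
    + by apply: cvg_at_left_filter; apply: cG.
  - move=> u; rewrite in_itv/= => /andP[ku _].
    rewrite derive1E; apply: (@derive_val _ _ _ _ _ _ _ (dG u _)).
    by rewrite (lt_trans _ ku)// invr_gt0.
under eq_fun do rewrite Fk.
apply: cvg_EFin; first exact: nearW.
rewrite -[X in _ --> X]subr0 -[X in _ --> _ - X](mulr0 p^-1).
apply: cvgB; first exact: cvg_cst.
apply: cvgM; first exact: cvg_cst.
have H0 : (k.+1%:R^-1 : R) @[k --> \oo] --> 0^'+.
  move=> B B0.
  have : \forall k \near \oo, (0 : R) < harmonic k -> B (@harmonic R k).
    exact: (@cvg_harmonic R _ B0).
  change ((\forall k \near \oo, (0 : R) < harmonic k -> B (@harmonic R k)) ->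
    \forall k \near \oo, B (@harmonic R k)).
  by apply: filterS => k; apply; rewrite invr_gt0.
exact: (cvg_comp _ _ H0 (powR_cvg0 p0)).
Qed.

Definition gamma_kernel (p u : R) : R := u `^ (p - 1) * expR (- u).

(** The gamma and beta integrals as extended reals: Tonelli applies before
   anything is known about their finiteness. *)
Definition egamma (p : R) : \bar R :=
  (\int[mu]_(u in `]0%R, +oo[) (gamma_kernel p u)%:E)%E.

Definition ebeta (p q : R) : \bar R :=
  (\int[mu]_(w in `]0%R, 1%R[) (w `^ (p - 1) * (1 - w) `^ (q - 1))%:E)%E.

Lemma measurable_subr (c : R) (D : set R) : measurable_fun D (fun u : R => c - u).
Proof. by apply: measurable_funTS; exact: measurable_funB. Qed.

Lemma measurable_gamma_kernel (p : R) (D : set R) :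
  measurable_fun D (gamma_kernel p).
Proof.
apply: measurable_funTS; apply: measurable_funM; first exact: measurable_powR.
apply: measurableT_comp; first exact: measurable_expR.
exact: measurable_funN.
Qed.

Lemma gamma_kernel_ge0 (p u : R) : 0 <= gamma_kernel p u.
Proof. by rewrite mulr_ge0 ?powR_ge0 ?expR_ge0. Qed.

Lemma ebeta_ge0 (p q : R) : (0 <= ebeta p q)%E.
Proof. by apply: integral_ge0 => w _; rewrite lee_fin mulr_ge0 ?powR_ge0. Qed.

Lemma measurable_beta_kernel (a b p q : R) (D : set R) :
  measurable_fun D (fun s : R => ((s - a) `^ (p - 1) * (b - s) `^ (q - 1))%:E).
Proof.
apply/measurable_EFinP; apply: measurable_funTS; apply: measurable_funM.
  apply: (measurableT_comp (measurable_powR (p - 1))).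
  exact: measurable_funB.
apply: (measurableT_comp (measurable_powR (q - 1))).
exact: measurable_subr.
Qed.

Lemma beta_kernel_ge0 (a b p q s : R) :
  (0 <= ((s - a) `^ (p - 1) * (b - s) `^ (q - 1))%:E)%E.
Proof. by rewrite lee_fin mulr_ge0 ?powR_ge0. Qed.

Lemma beta_integral_itv (a b p q : R) : a < b ->
  (\int[mu]_(s in `]a, b[) ((s - a) `^ (p - 1) * (b - s) `^ (q - 1))%:E =
   ((b - a) `^ (p + q - 1))%:E * ebeta p q)%E.
Proof.
move=> ab; have ba0 : 0 < b - a by rewrite subr_gt0.
have nz : b - a != 0 by rewrite gt_eqF.
have pre : (fun w => (b - a) * w + a) @^-1` `]a, b[ = `]0, 1[%classic.
  by rewrite preimage_affine_itv// subrr mul0r divff// gt_eqF.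
have := ge0_integral_affine
  (f := fun s : R => ((s - a) `^ (p - 1) * (b - s) `^ (q - 1))%:E) a ba0
  (measurable_itv `]a, b[) (@measurable_beta_kernel a b p q _)
  (fun s _ => beta_kernel_ge0 a b p q s).
rewrite pre => ->.
transitivity ((b - a)%:E * \int[mu]_(w in `]0%R, 1%R[)
   (((b - a) `^ (p + q - 2))%:E * (w `^ (p - 1) * (1 - w) `^ (q - 1))%:E))%E.
  congr (_ * _)%E; apply: eq_integral => w; rewrite inE/= in_itv/= => /andP[w0 w1].
  rewrite -EFinM addrK; congr EFin.
  have -> : b - ((b - a) * w + a) = (b - a) * (1 - w) by ring.
  rewrite !powRM ?subr_ge0 ?(ltW w0) ?(ltW w1) ?(ltW ab)//.
  have -> : p + q - 2 = (p - 1) + (q - 1) by ring.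
  by rewrite (@powRD _ (b - a) (p - 1) (q - 1)) ?nz ?implybT//; ring.
rewrite ge0_integralZl; last 4 first.
- exact: measurable_itv.
- have := @measurable_beta_kernel 0 1 p q `]0, 1[%classic.
  by congr (measurable_fun _ _); apply/funext => s; rewrite subr0.
- by move=> w _; rewrite lee_fin mulr_ge0 ?powR_ge0.
- by rewrite lee_fin powR_ge0.
rewrite muleA -EFinM; congr (_%:E * _)%E.
rewrite -[X in X * _](powRr1 (ltW ba0)) -powRD ?nz ?implybT//.
by congr (_ `^ _); ring.
Qed.

Definition gamma_density (p : R) : R -> R := gamma_kernel p \_ `]0, +oo[.

Lemma gamma_density_ge0 (p u : R) : 0 <= gamma_density p u.
Proof.
by rewrite /gamma_density patchE; case: ifP => // _; exact: gamma_kernel_ge0.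
Qed.

Lemma gamma_density_le0 (p u : R) : u <= 0 -> gamma_density p u = 0.
Proof.
move=> u0; rewrite /gamma_density patchE ifF// mem_setE in_itv/= andbT.
by apply/negbTE; rewrite -leNgt.
Qed.

Lemma gamma_density_gt0 (p u : R) :
  0 < u -> gamma_density p u = gamma_kernel p u.
Proof.
by move=> u0; rewrite /gamma_density patchE ifT// mem_setE in_itv/= u0.
Qed.

Lemma measurable_gamma_density (p : R) : measurable_fun setT (gamma_density p).
Proof.
by apply/(measurable_restrictT _ _).1 => //; exact: measurable_gamma_kernel.
Qed.

Lemma egammaE (p : R) : egamma p = (\int[mu]_u (gamma_density p u)%:E)%E.
Proof. by rewrite /egamma integral_mkcond restrict_EFin. Qed.

(** The product of exponentials is constant in u, which leaves a beta integral
   over ]0, r[. *)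
Lemma gamma_convolution (p q r : R) :
  (\int[mu]_u (gamma_density p u * gamma_density q (r - u))%:E =
   (gamma_density (p + q) r)%:E * ebeta p q)%E.
Proof.
have [r0|r0] := leP r 0.
  rewrite (gamma_density_le0 _ r0) mul0e.
  apply: integral0_eq => u _; congr EFin.
  have [u0|u0] := leP (u : R) 0; first by rewrite (gamma_density_le0 _ u0) mul0r.
  have -> : gamma_density q (r - u) = 0; last by rewrite mulr0.
  by apply: gamma_density_le0; rewrite subr_le0 (le_trans r0)// ltW.
transitivity (\int[mu]_(u in `]0%R, r[)
   ((expR (- r))%:E * ((u - 0) `^ (p - 1) * (r - u) `^ (q - 1))%:E))%E.
  rewrite [RHS]integral_mkcond; apply: eq_integral => u _.
  rewrite patchE mem_setE in_itv/=.
  have [u0|u0] /= := ltP 0 (u : R); last by rewrite (gamma_density_le0 _ u0) mul0r.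
  have [ur|ur] /= := ltP (u : R) r; last first.
    have -> : gamma_density q (r - u) = 0; last by rewrite mulr0.
    by apply: gamma_density_le0; rewrite subr_le0.
  rewrite (gamma_density_gt0 _ u0) gamma_density_gt0 ?subr_gt0//.
  rewrite -EFinM /gamma_kernel subr0; congr EFin.
  have -> : expR (- r) = expR (- u) * expR (- (r - u)).
    by rewrite -expRD; congr expR; ring.
  ring.
rewrite ge0_integralZl; last 4 first.
- exact: measurable_itv.
- exact: measurable_beta_kernel.
- by move=> u _; exact: beta_kernel_ge0.
- by rewrite lee_fin expR_ge0.
rewrite beta_integral_itv// subr0 muleA -EFinM; congr (_%:E * _)%E.
by rewrite (gamma_density_gt0 _ r0) /gamma_kernel mulrC.
Qed.

(** Translating the inner variable turns the product of two gamma integrals into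
   the integral of a convolution, and Tonelli lets one integrate in u first. *)
Lemma egammaM (p q : R) :
  (egamma p * egamma q = ebeta p q * egamma (p + q))%E.
Proof.
pose W := gamma_density; have W0 := gamma_density_ge0.
have mW := measurable_gamma_density.
have mWE p' : measurable_fun setT (fun u : R => (W p' u)%:E).
  exact/measurable_EFinP.
have mWWu u : measurable_fun setT (fun r : R => (W q (r - u))%:E).
  apply/measurable_EFinP; apply: measurableT_comp => //; exact: measurable_funB.
have mWW : measurable_fun setT
    (fun ur : R * R => (W p ur.1 * W q (ur.2 - ur.1))%:E).
  apply/measurable_EFinP; apply: measurable_funM.
    exact: measurableT_comp.
  apply: (measurableT_comp (mW q)).
  exact: measurable_funB.
transitivity (\int[mu]_u \int[mu]_r (W p u * W q (r - u))%:E)%E.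
  rewrite {1}egammaE -ge0_integralZr//; last 3 first.
  - exact: mWE.
  - by move=> u _; rewrite lee_fin.
  - by apply: integral_ge0 => u _; rewrite lee_fin gamma_kernel_ge0.
  apply: eq_integral => u _.
  have W0E v : setT v -> (0 <= (W q v)%:E)%E by rewrite lee_fin.
  rewrite egammaE.
  have -> := ge0_integral_affine (- u) (@ltr01 R) measurableT (mWE q) W0E.
  rewrite mul1e preimage_setT -ge0_integralZl//.
  - by apply: eq_integral => r _; rewrite mul1r EFinM.
  - by have := mWWu u; under eq_fun do rewrite -[X in X - u]mul1r; exact.
  - by move=> r _; rewrite lee_fin.
  - by rewrite lee_fin.
have ft := @fubini_tonelli _ _ _ _ R mu mu _ mWW.
rewrite /fubini_F /fubini_G/= in ft; rewrite ft; last first.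
  by move=> [u r]; rewrite lee_fin mulr_ge0.
transitivity (\int[mu]_r ((W (p + q) r)%:E * ebeta p q))%E; last first.
  rewrite ge0_integralZr; first by rewrite muleC -egammaE.
  - exact: measurableT.
  - exact: mWE.
  - by move=> u _; rewrite lee_fin.
  - exact: ebeta_ge0.
by apply: eq_integral => r _; exact: gamma_convolution.
Qed.

Lemma integral_expR_half :
  (\int[mu]_(u in `[0%R, +oo[) (expR (- 2^-1 * u))%:E = 2%:E)%E.
Proof.
have := @integral_exponential_pdf R 2^-1.
rewrite invr_gt0 ltr0n => /(_ isT) H.
have : (\int[mu]_(u in `[0%R, +oo[) (2^-1 * expR (- 2^-1 * u))%:E = 1)%E.
  by rewrite -H /exponential_pdf integral_mkcond restrict_EFin.
under eq_integral do rewrite EFinM.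
have mE : measurable_fun (`[0%R, +oo[%classic : set R)
    (fun u : R => (expR (- 2^-1 * u))%:E).
  apply/measurable_EFinP; apply: measurable_funTS.
  apply: measurableT_comp; first exact: measurable_expR.
  exact: measurable_funM.
rewrite ge0_integralZl; last 4 first.
- exact: measurable_itv.
- exact: mE.
- by move=> u _; rewrite lee_fin expR_ge0.
- by rewrite lee_fin invr_ge0.
move=> E; rewrite -[LHS]mul1e -[X in (X * _)%E](_ : (2 * 2^-1)%:E = 1%E).
  by rewrite EFinM -muleA E mule1.
by rewrite divff.
Qed.

(** Near 0 the kernel is at most u^(p-1), and beyond 1 it decays like
   exp(-u/2) because u^m is at most a multiple of exp(u/2). *)
Lemma egamma_lty (p : R) : 0 < p -> (egamma p < +oo)%E.
Proof.
move=> p0.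
have mk (D : set R) : measurable_fun D (fun u : R => (gamma_kernel p u)%:E).
  by apply/measurable_EFinP; exact: measurable_gamma_kernel.
have -> : egamma p = (\int[mu]_(u in `]0%R, 1%R[) (gamma_kernel p u)%:E
    + \int[mu]_(u in `[1%R, +oo[) (gamma_kernel p u)%:E)%E.
  rewrite /egamma.
  rewrite -(@ge0_integral_setU _ _ _ mu `]0%R, 1%R[%classic `[1%R, +oo[%classic).
  - congr (\int[mu]_(u in _) _)%E; apply/seteqP.
    split=> u /=; rewrite !in_itv/= !andbT.
      by move=> ->; case: ltP => _; [left|right].
    by move=> [/andP[]//|]; exact: lt_le_trans.
  - exact: measurable_itv.
  - exact: measurable_itv.
  - exact: mk.
  - by move=> u _; rewrite lee_fin gamma_kernel_ge0.
  - apply/disj_setPS => u /=; rewrite !in_itv/= andbT => -[/andP[_ u1]].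
    by rewrite leNgt u1.
apply: lte_add_pinfty.
  apply: (@le_lt_trans _ _ (\int[mu]_(u in `]0%R, 1%R[) (u `^ (p - 1))%:E)%E).
    apply: ge0_le_integral.
    - exact: measurable_itv.
    - by move=> u _; rewrite lee_fin gamma_kernel_ge0.
    - exact: mk.
    - apply/measurable_EFinP/measurable_funTS; exact: measurable_powR.
    - move=> u; rewrite /= in_itv/= => /andP[u0 _]; rewrite lee_fin.
      by rewrite ler_piMr ?powR_ge0// expR_le1 oppr_le0 ltW.
  by rewrite integral_powR01// ltry.
(* Any natural m >= p - 1 will do; a successor matches expR_ge1Dxn. *)
pose m := (Num.truncn p).+1.
have m1 : p - 1 <= m%:R.
  by rewrite lerBlDr (le_trans (ltW (truncnS_gt p)))// lerDl.
pose C : R := m`!%:R * 2 ^+ m.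
have kE (u : R) : 1 <= u -> gamma_kernel p u <= C * expR (- 2^-1 * u).
  move=> u1; have u0 : 0 < u by exact: lt_le_trans u1.
  have -> : expR (- 2^-1 * u) = expR (u / 2) * expR (- u).
    by rewrite -expRD; congr expR; field.
  rewrite mulrA ler_pM2r ?expR_gt0//.
  rewrite (le_trans (ler_powR u1 m1))// powR_mulrn ?(ltW u0)//.
  have /(expR_ge1Dxn m.-1) : 0 <= u / 2 by rewrite divr_ge0// ltW.
  rewrite -/m /= => h.
  have {}h : (u / 2) ^+ m / m`!%:R <= expR (u / 2).
    by rewrite (le_trans _ h)// lerDr.
  move: h; rewrite ler_pdivrMr ?ltr0n ?fact_gt0//.
  rewrite expr_div_n ler_pdivrMr ?exprn_gt0//.
  have -> // : C * expR (u / 2) = expR (u / 2) * m`!%:R * 2 ^+ m.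
  by rewrite /C mulrC mulrA.
have mE (D : set R) : measurable_fun D (fun u : R => (expR (- 2^-1 * u))%:E).
  apply/measurable_EFinP; apply: measurable_funTS.
  apply: measurableT_comp; first exact: measurable_expR.
  exact: measurable_funM.
have mCE (D : set R) :
    measurable_fun D (fun u : R => (C%:E * (expR (- 2^-1 * u))%:E)%E).
  by apply: measurable_funeM; exact: mE.
have C0 : 0 <= C by rewrite mulr_ge0// exprn_ge0.
apply: (@le_lt_trans _ _
  (\int[mu]_(u in `[0%R, +oo[) (C%:E * (expR (- 2^-1 * u))%:E))%E).
  apply: (@le_trans _ _
    (\int[mu]_(u in `[1%R, +oo[) (C%:E * (expR (- 2^-1 * u))%:E))%E).
    apply: ge0_le_integral.
    - exact: measurable_itv.
    - by move=> u _; rewrite lee_fin gamma_kernel_ge0.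
    - exact: mk.
    - exact: mCE.
    - by move=> u; rewrite /= in_itv/= andbT => u1; rewrite -EFinM lee_fin kE.
  apply: ge0_subset_integral.
  - exact: measurable_itv.
  - exact: measurable_itv.
  - exact: mCE.
  - by move=> u _; rewrite -EFinM lee_fin mulr_ge0 ?expR_ge0.
  - by move=> u /=; rewrite !in_itv/= !andbT; exact: le_trans.
rewrite ge0_integralZl; last 4 first.
- exact: measurable_itv.
- exact: mE.
- by move=> u _; rewrite lee_fin expR_ge0.
- by rewrite lee_fin.
by rewrite integral_expR_half -EFinM ltry.
Qed.

Lemma EFin_Gamma (p : R) : 0 < p -> (Gamma p)%:E = egamma p.
Proof.
move=> p0; rewrite /Gamma /Rintegral fineK// ge0_fin_numE.
  exact: egamma_lty.
by apply: integral_ge0 => u _; rewrite lee_fin gamma_kernel_ge0.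
Qed.

(** The kernel is bounded below on the interval ]N, N + 1[ alone. *)
Lemma Gamma_lower_bound (N p : R) : 0 < N -> 0 < p ->
  N `^ p / (N + 1) * expR (- (N + 1)) <= Gamma p.
Proof.
move=> N0 p0; rewrite -lee_fin EFin_Gamma//.
have N1 : 0 < N + 1 by rewrite addr_gt0.
set c : R := N `^ p / (N + 1) * expR (- (N + 1)).
have c0 : 0 <= c by rewrite !mulr_ge0 ?powR_ge0 ?expR_ge0 ?invr_ge0 ?ltW.
have mk (D : set R) : measurable_fun D (fun u : R => (gamma_kernel p u)%:E).
  by apply/measurable_EFinP; exact: measurable_gamma_kernel.
apply: (@le_trans _ _ (\int[mu]_(u in `]N, (N + 1)%R[) (gamma_kernel p u)%:E)%E).
  have -> : c%:E = (\int[mu]_(u in `]N, (N + 1)%R[) (cst c%:E u))%E.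
    rewrite integral_cst; last exact: measurable_itv.
    have M : mu `]N, (N + 1)%R[ = 1%E.
      rewrite lebesgue_measure_itv/= lte_fin ltrDl ltr01.
      by rewrite -EFinB addrAC subrr add0r.
    exact: (esym (etrans (congr1 _ M) (mule1 _))).
  apply: ge0_le_integral.
  - exact: measurable_itv.
  - by move=> u _; rewrite lee_fin.
  - exact: measurable_cst.
  - exact: mk.
  - move=> u; rewrite /= in_itv/= => /andP[Nu uN]; rewrite lee_fin /c.
    have u0 : 0 < u by exact: lt_trans Nu.
    rewrite /gamma_kernel ler_pM ?expR_ge0 ?divr_ge0 ?powR_ge0 ?(ltW N1)//.
      have -> : (u : R) `^ (p - 1) = u `^ p / u.
        by rewrite powRB ?powRr1 ?(ltW u0)// (gt_eqF u0) implybT.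
      rewrite ler_pM ?powR_ge0 ?invr_ge0 ?(ltW N1)//.
        by rewrite ge0_ler_powR ?nnegrE ?ltW.
      by rewrite lef_pV2 ?posrE// ltW.
    by rewrite ler_expR lerN2 ltW.
apply: ge0_subset_integral.
- exact: measurable_itv.
- exact: measurable_itv.
- exact: mk.
- by move=> u _; rewrite lee_fin gamma_kernel_ge0.
- by move=> u /=; rewrite !in_itv/= andbT => /andP[Nu _]; exact: lt_trans Nu.
Qed.

Lemma Gamma_gt0 (p : R) : 0 < p -> 0 < Gamma p.
Proof.
move=> p0; apply: lt_le_trans (Gamma_lower_bound (@ltr01 R) p0).
by rewrite mulr_gt0 ?expR_gt0// divr_gt0 ?powR_gt0// addr_gt0.
Qed.

(** Dividing by the gamma integral at p + q is legitimate because it is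
   positive; the same positivity forces the beta integral to be finite. *)
Lemma ebetaE (p q : R) : 0 < p -> 0 < q ->
  ebeta p q = (Gamma p * Gamma q / Gamma (p + q))%:E.
Proof.
move=> p0 q0; have pq0 : 0 < p + q by rewrite addr_gt0.
have := egammaM p q; rewrite -!EFin_Gamma// => h.
have G0 : (0 < (Gamma (p + q))%:E)%E by rewrite lte_fin Gamma_gt0.
have fB : ebeta p q \is a fin_num.
  rewrite ge0_fin_numE ?ebeta_ge0// ltNge leye_eq; apply/negP => /eqP B.
  by move: h; rewrite B gt0_mulye.
move: h; rewrite -(fineK fB) -!EFinM => -[h]; congr EFin.
by rewrite h mulfK// gt_eqF// Gamma_gt0.
Qed.

Lemma Gamma1 : Gamma (1 : R) = 1.
Proof.
apply: EFin_inj; rewrite EFin_Gamma//.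
transitivity (\int[mu]_(u in `[0%R, +oo[) (1 * expR (- 1 * u))%:E)%E; last first.
  rewrite -[RHS](@integral_exponential_pdf R 1 ltr01).
  by rewrite /exponential_pdf integral_mkcond restrict_EFin.
rewrite /egamma [LHS]integral_itv_obnd_cbnd.
  apply: eq_integral => u _; rewrite /gamma_kernel subrr powRr0.
  by rewrite !mul1r mulN1r.
by apply/measurable_EFinP; exact: measurable_gamma_kernel.
Qed.

(** The beta integral with q = 1 is elementary, so its gamma expression gives
   the recursion. *)
Lemma GammaD1 (p : R) : 0 < p -> Gamma (p + 1) = p * Gamma p.
Proof.
move=> p0; have p10 : 0 < p + 1 by rewrite addr_gt0.
have : ebeta p 1 = (p^-1)%:E.
  rewrite -integral_powR01//; apply: eq_integral => w _.
  by rewrite subrr powRr0 mulr1.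
rewrite ebetaE// Gamma1 mulr1 => -[h].
have /(congr1 (fun x => x * p * Gamma (p + 1))) := h.
rewrite mulVf ?gt_eqF// mul1r => <-.
by field; rewrite !gt_eqF// Gamma_gt0.
Qed.

Lemma beta_integral (a b p q : R) : a < b -> 0 < p -> 0 < q ->
  (\int[mu]_(s in `]a, b[) ((s - a) `^ (p - 1) * (b - s) `^ (q - 1))%:E =
   ((b - a) `^ (p + q - 1) * (Gamma p * Gamma q / Gamma (p + q)))%:E)%E.
Proof. by move=> ab p0 q0; rewrite beta_integral_itv// ebetaE// EFinM. Qed.

Lemma integrable_beta (a b p q : R) : 0 < p -> 0 < q ->
  mu.-integrable `]a, b[
    (EFin \o (fun s => (s - a) `^ (p - 1) * (b - s) `^ (q - 1))).
Proof.
move=> p0 q0; apply/integrableP; split; first exact: measurable_beta_kernel.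
have [ab|ba] := ltP a b.
  under eq_integral do rewrite gee0_abs ?beta_kernel_ge0//.
  by rewrite beta_integral// ltry.
by rewrite set_itv_ge ?bnd_simp -?leNgt// integral_set0 ltry.
Qed.

Lemma Rintegral_beta (a b p q : R) : a < b -> 0 < p -> 0 < q ->
  \int[mu]_(s in `]a, b[) ((s - a) `^ (p - 1) * (b - s) `^ (q - 1)) =
  (b - a) `^ (p + q - 1) * (Gamma p * Gamma q / Gamma (p + q)).
Proof. by move=> ab p0 q0; rewrite /Rintegral beta_integral. Qed.

End gamma_beta.

(** * Linearity of the Caputo derivative *)

Section real_functions.
Variable R : realType.
Implicit Types (f g : R -> R) (c z : R).
Notation mu := (@lebesgue_measure R).

Lemma measurable_itvoo c z : @measurable _ (measurableTypeR R) `]c, z[%classic.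
Proof. exact: measurable_itv. Qed.

Lemma near_itvoo c z s : c < s < z -> \forall u \near s, c < u < z.
Proof.
move=> /andP[cs sz]; near=> u; apply/andP; split.
  by near: u; exact: lt_nbhsr.
by near: u; exact: lt_nbhsl.
Unshelve. all: by end_near. Qed.

Lemma eq_itvoo_derivable f g c z s : (forall u, c < u < z -> f u = g u) ->
  c < s < z -> derivable f s 1 -> derivable g s 1.
Proof.
move=> fg csz; apply: near_eq_derivable.
by apply: filterS (near_itvoo csz) => u; exact: fg.
Qed.

Lemma eq_itvoo_derive1 f g c z s : (forall u, c < u < z -> f u = g u) ->
  c < s < z -> derive1 f s = derive1 g s.
Proof.
move=> fg csz; rewrite !derive1E; apply: near_eq_derive.
by apply: filterS (near_itvoo csz) => u; exact: fg.
Qed.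

Lemma derive1_add f g s : derivable f s 1 -> derivable g s 1 ->
  derive1 (fun u => f u + g u) s = derive1 f s + derive1 g s.
Proof. by move=> df dg; rewrite !derive1E -deriveD. Qed.

Lemma derive1_scale k f s : derivable f s 1 ->
  derive1 (fun u => k * f u) s = k * derive1 f s.
Proof. by move=> df; rewrite !derive1E -[RHS]/(k *: _) -deriveZ. Qed.

(** A derivative is the pointwise limit of difference quotients along the steps
   1/(n + 1); extending the function by zero keeps these quotients measurable
   when a step leaves the interval. *)
Lemma measurable_derive1 f c z :
  (forall s, c < s < z -> derivable f s 1) -> measurable_fun `]c, z[ (derive1 f).
Proof.
move=> df; pose g := f \_ `]c, z[.
have fg s : c < s < z -> f s = g s.
  by move=> csz; rewrite /g patchE ifT// mem_setE in_itv.
have mg : measurable_fun setT g.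
  apply/(measurable_restrictT _ _).1 => //.
  apply: open_continuous_measurable_fun => [|s].
    exact: interval_open.
  rewrite inE/= in_itv/= => /df ?.
  exact/differentiable_continuous/derivable1_diffP.
apply: (@measurable_fun_cvg _ _ R `]c, z[
    (fun n s => (@harmonic R n)^-1 * (g (harmonic n + s) - g s))).
  move=> n; apply: measurable_funTS; apply: measurable_funM => //.
  apply: measurable_funB => //; apply: measurableT_comp => //.
  exact: measurable_funD.
move=> s; rewrite /= in_itv/= => csz.
rewrite (eq_itvoo_derive1 fg csz).
have dg : derivable g s 1 by exact: eq_itvoo_derivable fg csz (df s csz).
have h0 : @harmonic R n @[n --> \oo] --> 0^'.
  move=> B B0.
  have : \forall n \near \oo, @harmonic R n != 0 -> B (@harmonic R n).
    exact: (@cvg_harmonic R _ B0).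
  change ((\forall n \near \oo, @harmonic R n != 0 -> B (@harmonic R n)) ->
    \forall n \near \oo, B (@harmonic R n)).
  by apply: filterS => n; apply; rewrite invr_eq0 pnatr_eq0.
have := cvg_comp _ _ h0 dg.
rewrite -/('D_1 g s) -derive1E.
apply: cvg_trans; apply: near_eq_cvg; apply: nearW => n /=.
by rewrite /GRing.scale/= mulr1.
Qed.

Lemma integrable_dominated (D : set R) f g : measurable D ->
  measurable_fun D f -> (forall s, D s -> `|f s| <= g s) ->
  mu.-integrable D (EFin \o g) -> mu.-integrable D (EFin \o f).
Proof.
move=> mD mf fg; apply: le_integrable => //; first exact/measurable_EFinP.
by move=> s Ds /=; rewrite lee_fin (le_trans (fg s Ds))// ler_norm.
Qed.

End real_functions.

Section caputo.
Variables (R : realType) (alpha : R).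
Hypothesis halpha : 0 < alpha < 1.
Implicit Types (f g : R -> R) (c z : R).
Notation mu := (@lebesgue_measure R).

Let alpha0 : 0 < alpha. Proof. by case/andP: halpha. Qed.
Let alpha1 : 0 < 1 - alpha. Proof. by rewrite subr_gt0; case/andP: halpha. Qed.

Lemma caputoE f c z : caputo alpha c f z =
  (Gamma (1 - alpha))^-1 *
  \int[mu]_(s in `]c, z[) (derive1 f s / (z - s) `^ alpha).
Proof.
have t0 : Num.truncn alpha = 0%N.
  by apply: truncn_def; rewrite ltW//=; case/andP: halpha.
by rewrite /caputo t0 gt_eqF// derive1n1 addrK.
Qed.

(** The differentiability and integrability that linearity at z rests on.
   Iterated derivatives of smooth functions have them even where their
   derivative blows up at c. *)
Definition has_caputo f c z : Prop :=
  (forall s, c < s < z -> derivable f s 1) /\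
  mu.-integrable `]c, z[ (EFin \o (fun s => derive1 f s / (z - s) `^ alpha)).

Lemma caputo_derivable_has_caputo f c z :
  caputo_derivable alpha c f z -> has_caputo f c z.
Proof. by case. Qed.

Lemma has_caputo_empty f c z : z <= c -> has_caputo f c z.
Proof.
move=> zc; split=> [s /andP[cs sz]|].
  by have := lt_trans cs sz; rewrite ltNge zc.
by rewrite set_itv_ge ?bnd_simp -?leNgt//; exact: integrable_set0.
Qed.

Lemma caputo_empty f c z : z <= c -> caputo alpha c f z = 0.
Proof.
move=> zc; rewrite caputoE set_itv_ge ?bnd_simp -?leNgt//.
by rewrite Rintegral_set0 mulr0.
Qed.

Lemma eq_caputo f g c z : (forall s, c < s < z -> f s = g s) ->
  caputo alpha c f z = caputo alpha c g z.
Proof.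
move=> fg; rewrite !caputoE; apply: (congr1 ( *%R _)); apply: eq_Rintegral => s.
by rewrite inE/= in_itv/= => csz; rewrite (eq_itvoo_derive1 fg csz).
Qed.

Lemma eq_has_caputo f g c z : (forall s, c < s < z -> f s = g s) ->
  has_caputo f c z -> has_caputo g c z.
Proof.
move=> fg [df intf]; split=> [s csz|].
  exact: eq_itvoo_derivable fg csz (df s csz).
apply: eq_integrable intf => // s; rewrite inE/= in_itv/= => csz.
by rewrite (eq_itvoo_derive1 fg csz).
Qed.

Lemma has_caputoZ k f c z : has_caputo f c z -> has_caputo (fun s => k * f s) c z.
Proof.
move=> [df intf]; split=> [s csz|].
  by apply: derivableZ; exact: df.
have := integrableZl (measurable_itvoo c z) k intf.
apply: eq_integrable => //= s; rewrite inE/= in_itv/= => csz.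
by rewrite derive1_scale -?mulrA//; exact: df.
Qed.

Lemma caputoD f g c z : has_caputo f c z -> has_caputo g c z ->
  caputo alpha c (fun s => f s + g s) z = caputo alpha c f z + caputo alpha c g z.
Proof.
move=> [df intf] [dg intg]; rewrite !caputoE -mulrDr; congr (_ * _).
rewrite -RintegralD//; apply: eq_Rintegral => s.
rewrite inE/= in_itv/= => csz.
by rewrite derive1_add ?mulrDl//; [exact: df|exact: dg].
Qed.

Lemma caputoZ k f c z : has_caputo f c z ->
  caputo alpha c (fun s => k * f s) z = k * caputo alpha c f z.
Proof.
move=> [df intf]; rewrite !caputoE mulrCA; congr (_ * _).
rewrite -RintegralZl//; apply: eq_Rintegral => s.
rewrite inE/= in_itv/= => csz.
by rewrite derive1_scale -?mulrA//; exact: df.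
Qed.

(** The bound turns the integrand into a beta kernel. *)
Lemma has_caputo_bound (r C : R) f c z : 0 < r ->
  (forall s, c < s < z -> derivable f s 1) ->
  (forall s, c < s < z -> `|derive1 f s| <= C * (s - c) `^ (r - 1)) ->
  has_caputo f c z.
Proof.
move=> r0 df f'C; split=> //.
have h := integrableZl (measurable_itvoo c z) C (integrable_beta c z r0 alpha1).
apply: (@integrable_dominated _ _ _ (fun s => C * ((s - c) `^ (r - 1) *
    (z - s) `^ (1 - alpha - 1)))).
- exact: measurable_itv.
- apply: measurable_funM; first exact: measurable_derive1.
  apply: measurable_funTS.
  rewrite (_ : (fun _ => _) = (fun s : R => (z - s) `^ (- alpha))); last first.
    by apply/funext => s; rewrite powRN.
  apply: (measurableT_comp (measurable_powR (- alpha))).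
  exact: measurable_subr.
- move=> s; rewrite /= in_itv/= => csz.
  rewrite normrM normfV [`|_ `^ alpha|]ger0_norm ?powR_ge0//.
  have -> : 1 - alpha - 1 = - alpha by ring.
  by rewrite powRN mulrA ler_wpM2r ?invr_ge0 ?powR_ge0// f'C.
- exact: h.
Qed.

End caputo.

(** * The Mittag-Leffler function *)

Section entire.
Variable R : realType.
Implicit Types (c : R^nat) (x : R).

(** Equivalent to an infinite radius of convergence, in a form that passes at
   once to the differentiated series. *)
Definition entire c :=
  forall x, 0 < x -> exists C, forall k, `|c k| * x ^+ k <= C.

(** The factor k + 1 is absorbed by doubling the radius. *)
Lemma entire_diffs c : entire c -> entire (pseries_diffs c).
Proof.
move=> ec x x0; have x20 : 0 < 2 * x by rewrite mulr_gt0.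
have [C cC] := ec _ x20; exists (C / x) => k.
rewrite ler_pdivlMr// -mulrA -exprSr /pseries_diffs normrM ger0_norm//.
apply: le_trans (cC k.+1); rewrite exprMn mulrCA mulrA.
rewrite ler_pM2r ?exprn_gt0// mulrC (mulrC (2 ^+ _)) ler_wpM2l//.
by rewrite -natrX ler_nat ltnW// ltn_expl.
Qed.

Lemma entire_norm c : entire c -> entire (fun k => `|c k|).
Proof.
by move=> ec x x0; have [C cC] := ec x x0; exists C => k; rewrite normr_id.
Qed.

(** The bound at twice the radius gives a geometric majorant of ratio 1/2. *)
Lemma entire_cvg c x : entire c -> cvgn (pseries c x).
Proof.
move=> ec; apply: (@is_cvg_pseries_inside _ _ (`|x| + 1)); last first.
  by rewrite [ltRHS]ger0_norm ?addr_ge0// ltrDl.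
set X := `|x| + 1; have X0 : 0 < X by rewrite ltr_wpDl.
have [C cC] := ec (2 * X) (mulr_gt0 (ltr0n _ 2) X0).
apply: normed_cvg.
apply: (@series_le_cvg _ _ (geometric C 2^-1)) => [k|k|k|].
- exact: normr_ge0.
- rewrite /geometric/= mulr_ge0 ?exprn_ge0 ?invr_ge0//.
  by apply: le_trans (cC 0%N); rewrite expr0 mulr1.
- rewrite /geometric/= normrM [`|X ^+ k|]ger0_norm ?exprn_ge0 ?(ltW X0)//.
  by rewrite exprVn ler_pdivlMr ?exprn_gt0// -mulrA -exprMn (mulrC X).
- apply: is_cvg_geometric_series.
  by rewrite ger0_norm ?invr_ge0// invf_lt1// ltr1n.
Qed.

Lemma entire_is_derive c x : entire c ->
  is_derive x 1 (fun x => limn (pseries c x))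
    (limn (pseries (pseries_diffs c) x)).
Proof.
move=> ec; apply: (@pseries_snd_diffs _ c (`|x| + 1)).
- exact: entire_cvg.
- by apply: entire_cvg; exact: entire_diffs.
- by apply: entire_cvg; do 2 apply: entire_diffs.
- by rewrite [ltRHS]ger0_norm ?addr_ge0// ltrDl.
Qed.

Lemma pseries_norm_le c x (X : R) n : entire c -> `|x| <= X ->
  `|pseries c x n| <= limn (pseries (fun k => `|c k|) X).
Proof.
move=> ec xX.
have nd : nondecreasing_seq (pseries (fun k => `|c k|) X).
  apply/nondecreasing_seqP => k.
  rewrite /pseries seriesEnat/= big_nat_recr//= lerDl.
  by rewrite mulr_ge0// exprn_ge0// (le_trans _ xX).
have cX := @entire_cvg (fun k => `|c k|) X (entire_norm ec).
have H := nondecreasing_cvgn_le nd cX n.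
apply: le_trans H.
rewrite /pseries /series/= (le_trans (ler_norm_sum _ _ _))//.
apply: ler_sum => k _; rewrite normrM normrX ler_wpM2l//.
by rewrite lerXn2r// nnegrE (le_trans _ xX).
Qed.

Lemma lim_pseries_norm_le c x (X : R) : entire c -> `|x| <= X ->
  `|limn (pseries c x)| <= limn (pseries (fun k => `|c k|) X).
Proof.
move=> ec xX; rewrite -lim_norm; last exact: entire_cvg.
apply: limr_le; first by apply: is_cvg_norm; exact: entire_cvg.
by apply: nearW => n; exact: pseries_norm_le.
Qed.

End entire.

Section mittag_leffler.
Variables (R : realType) (alpha : R).
Hypothesis halpha : 0 < alpha < 1.
Notation mu := (@lebesgue_measure R).

Let alpha0 : 0 < alpha. Proof. by case/andP: halpha. Qed.
Let alpha1 : 0 < 1 - alpha. Proof. by rewrite subr_gt0; case/andP: halpha. Qed.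

Definition ml_coef (k : nat) : R := (Gamma (1 + alpha * k%:R))^-1.

Lemma mittag_lefflerE x : mittag_leffler alpha x = limn (pseries ml_coef x).
Proof.
rewrite /mittag_leffler /pseries; congr (limn (series _)).
by apply/funext => k; rewrite mulrC.
Qed.

Let arg_gt0 (k : nat) : 0 < 1 + alpha * k%:R.
Proof. by rewrite ltr_pwDl// mulr_ge0// ltW. Qed.

(** The lower bound for Gamma at the point N = x^(1/alpha) grows like x^k. *)
Lemma entire_ml_coef : entire ml_coef.
Proof.
move=> x x0; pose N := x `^ alpha^-1.
have N0 : 0 < N by rewrite powR_gt0.
have N1 : 0 < N + 1 by rewrite addr_gt0.
exists ((N + 1) / N * expR (N + 1)) => k.
have NE : N `^ (1 + alpha * k%:R) = N * x ^+ k.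
  rewrite powRD ?(gt_eqF N0) ?implybT// powRr1 ?(ltW N0)//; congr (_ * _).
  by rewrite /N -powRrM mulrA mulVf ?gt_eqF// mul1r powR_mulrn// ltW.
have := Gamma_lower_bound N0 (arg_gt0 k); rewrite NE expRN => h.
have G0 := Gamma_gt0 (arg_gt0 k).
rewrite /ml_coef ger0_norm ?invr_ge0 ?(ltW G0)// mulrC ler_pdivrMr//.
have -> : x ^+ k =
    (N + 1) / N * expR (N + 1) * (N * x ^+ k / (N + 1) / expR (N + 1)).
  by field; rewrite (gt_eqF N0) (gt_eqF N1) expR_eq0.
by rewrite ler_wpM2l// mulr_ge0 ?expR_ge0// divr_ge0 ?ltW.
Qed.

Let D := pseries_diffs ml_coef.

Let entireD : entire D := entire_diffs entire_ml_coef.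

Lemma is_derive_mittag_leffler (rho s : R) : 0 < s ->
  is_derive s 1 (fun s => mittag_leffler alpha (- rho * s `^ alpha))
    (limn (pseries D (- rho * s `^ alpha)) *
     (- rho * (alpha * s `^ (alpha - 1)))).
Proof.
move=> s0.
have dg : is_derive s 1 (fun u => - rho * u `^ alpha)
    (- rho * (alpha * s `^ (alpha - 1))) :=
  is_deriveZ (- rho) (is_derive1_powR alpha s0).
have df := entire_is_derive (- rho * s `^ alpha) entire_ml_coef.
have := @is_derive1_comp R _ (fun u => - rho * u `^ alpha) _ _ _ df dg.
congr (is_derive _ _ _ _).
by apply/funext => u; rewrite /= mittag_lefflerE.
Qed.

Lemma derive1_mittag_leffler (rho s : R) : 0 < s ->
  derive1 (fun s => mittag_leffler alpha (- rho * s `^ alpha)) s =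
  limn (pseries D (- rho * s `^ alpha)) * (- rho * (alpha * s `^ (alpha - 1))).
Proof.
move=> s0; rewrite derive1E.
exact: (@derive_val _ _ _ _ _ _ _ (is_derive_mittag_leffler rho s0)).
Qed.

Let arg_le (rho s t : R) : 0 < s < t ->
  `|- rho * s `^ alpha| <= `|rho| * t `^ alpha.
Proof.
move=> /andP[s0 st]; rewrite normrM normrN [`|_ `^ _|]ger0_norm ?powR_ge0//.
rewrite ler_wpM2l// ge0_ler_powR// ?nnegrE ?ltW//.
exact: lt_trans st.
Qed.

(** The derivative is at most a multiple of s^(alpha - 1), the derivative of
   s^alpha. *)
Lemma has_caputo_mittag_leffler (rho t : R) :
  has_caputo alpha (fun s => mittag_leffler alpha (- rho * s `^ alpha)) 0 t.
Proof.
pose C := limn (pseries (fun k => `|D k|) (`|rho| * t `^ alpha)) * (`|rho| * alpha).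
apply: (has_caputo_bound halpha (C := C) alpha0) => s st; have s0 := andP st.
  by have [] := is_derive_mittag_leffler rho s0.1.
rewrite derive1_mittag_leffler ?s0.1// !normrM normrN subr0 /C.
rewrite (ger0_norm (ltW alpha0)) [`|_ `^ (_ - 1)|]ger0_norm ?powR_ge0//.
rewrite !mulrA !ler_wpM2r ?powR_ge0 ?(ltW alpha0)//.
by apply: lim_pseries_norm_le => //; exact: arg_le.
Qed.

Lemma integrable_sum_nat (U : set R) (f : nat -> R -> R) n :
  @measurable _ (measurableTypeR R) U ->
  (forall k, mu.-integrable U (EFin \o f k)) ->
  mu.-integrable U (EFin \o (fun s => \sum_(0 <= k < n) f k s)).
Proof.
move=> mU intf; elim: n => [|n IH].
  rewrite (_ : _ \o _ = cst 0%E); first exact: integrable0.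
  by apply/funext => s /=; rewrite big_geq.
have := integrableD mU IH (intf n).
by apply: eq_integrable => // s _ /=; rewrite big_nat_recr.
Qed.

Lemma Rintegral_sum_nat (U : set R) (f : nat -> R -> R) n :
  @measurable _ (measurableTypeR R) U ->
  (forall k, mu.-integrable U (EFin \o f k)) ->
  \int[mu]_(s in U) (\sum_(0 <= k < n) f k s) =
  \sum_(0 <= k < n) \int[mu]_(s in U) f k s.
Proof.
move=> mU intf; elim: n => [|n IH].
  rewrite big_geq//; transitivity (\int[mu]_(s in U) cst 0 s).
    by apply: eq_Rintegral => s _; rewrite big_geq.
  by rewrite Rintegral_cst// mul0r.
rewrite big_nat_recr//= -IH -RintegralD//; last exact: integrable_sum_nat.
by apply: eq_Rintegral => s _; rewrite big_nat_recr.
Qed.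

(** Termwise, the beta integral and the recursion of Gamma send the power
   s^(alpha (k + 1)) to a multiple of s^(alpha k), which shifts the series by
   one index; dominated convergence justifies the exchange. *)
Lemma caputo_mittag_leffler (rho t : R) : 0 < t ->
  caputo alpha 0 (fun s => mittag_leffler alpha (- rho * s `^ alpha)) t =
  - rho * mittag_leffler alpha (- rho * t `^ alpha).
Proof.
move=> t0; rewrite caputoE//.
set E := fun s => mittag_leffler alpha (- rho * s `^ alpha).
have Ga : 0 < Gamma (1 - alpha) by exact: Gamma_gt0.
suff -> : \int[mu]_(s in `]0, t[) (derive1 E s / (t - s) `^ alpha) =
    Gamma (1 - alpha) * (- rho * E t) by rewrite mulKf// gt_eqF.
pose p (k : nat) : R := alpha * k.+1%:R.
have p0 k : 0 < p k by rewrite mulr_gt0.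
pose e (k : nat) : R := D k * (- rho) ^+ k.+1 * alpha.
(* The k-th term of the derivative, over (t - s)^alpha, is e k * B k s. *)
pose B k (s : R) : R := (s - 0) `^ (p k - 1) * (t - s) `^ (1 - alpha - 1).
pose F n (s : R) : R := \sum_(0 <= k < n) e k * B k s.
have mI : @measurable _ (measurableTypeR R) `]0, t[%classic.
  exact: measurable_itvoo.
have iB k : mu.-integrable `]0, t[ (EFin \o B k).
  exact: integrable_beta.
have ieB k : mu.-integrable `]0, t[ (EFin \o (fun s => e k * B k s)).
  by have := integrableZl mI (e k) (iB k); apply: eq_integrable.
have iF n : mu.-integrable `]0, t[ (EFin \o F n) by exact: integrable_sum_nat.
have FE n s : 0 < s < t -> F n s = pseries D (- rho * s `^ alpha) n *
    (- rho * (alpha * s `^ (alpha - 1))) / (t - s) `^ alpha.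
  move=> /andP[s0 st].
  rewrite /F /pseries/series/= !big_distrl/=; apply: eq_bigr => k _.
  rewrite /e /B subr0 exprMn exprS -(powR_mulrn k (powR_ge0 s alpha)) -powRrM.
  have -> : p k - 1 = alpha * k%:R + (alpha - 1) by rewrite /p -natr1; ring.
  have -> : 1 - alpha - 1 = - alpha by ring.
  rewrite (@powRD _ s (alpha * k%:R) (alpha - 1)) ?(gt_eqF s0) ?implybT//.
  by rewrite powRN; ring.
have intF n : \int[mu]_(s in `]0, t[) F n s =
    Gamma (1 - alpha) * (- rho * pseries ml_coef (- rho * t `^ alpha) n).
  rewrite Rintegral_sum_nat//.
  rewrite /pseries/series/= !big_distrr/=; apply: eq_bigr => k _.
  rewrite (RintegralZl (e k) mI (iB k)) Rintegral_beta// subr0.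
  have -> : p k + (1 - alpha) = 1 + alpha * k%:R by rewrite /p -natr1; ring.
  have -> : 1 + alpha * k%:R - 1 = alpha * k%:R by ring.
  have G1 : Gamma (p k) = (ml_coef k.+1 * (alpha * k.+1%:R))^-1.
    have -> : ml_coef k.+1 = (p k * Gamma (p k))^-1.
      by rewrite /ml_coef -/(p k) addrC (GammaD1 (p0 k)).
    rewrite -/(p k); field.
    by rewrite (gt_eqF (p0 k)) (gt_eqF (Gamma_gt0 (p0 k))).
  have c0 : ml_coef k.+1 != 0.
    by rewrite /ml_coef invr_eq0 gt_eqF// Gamma_gt0.
  rewrite G1 /e /D /pseries_diffs -/(ml_coef k) exprMn.
  rewrite -(powR_mulrn k (powR_ge0 t alpha)).
  rewrite -powRrM exprS; field.
  by rewrite c0 (gt_eqF alpha0) addrC natr1 pnatr_eq0.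
have cvgF s : `]0, t[%classic s ->
    (F n s)%:E @[n --> \oo] --> (derive1 E s / (t - s) `^ alpha)%:E.
  rewrite /= in_itv/= => st; apply: cvg_EFin; first exact: nearW.
  rewrite /comp/=; under eq_fun do rewrite (FE _ _ st).
  have [s0 _] := andP st.
  rewrite derive1_mittag_leffler//.
  by do 2 apply: cvgMr_tmp; exact: entire_cvg.
pose C := limn (pseries (fun k => `|D k|) (`|rho| * t `^ alpha)) * (`|rho| * alpha).
(* B 0 is the kernel s^(alpha - 1) (t - s)^(- alpha). *)
pose g (s : R) : R := C * B 0%N s.
have ig : mu.-integrable `]0, t[ (EFin \o g).
  by have := integrableZl mI C (iB 0%N); apply: eq_integrable.
have Fg s n : `]0, t[%classic s -> `|F n s| <= g s.
  rewrite /= in_itv/= => st; rewrite FE// /g /C /B /p mulr1 subr0.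
  have -> : 1 - alpha - 1 = - alpha by ring.
  rewrite powRN !normrM normrN normfV !mulrA.
  rewrite (ger0_norm (ltW alpha0)) !(ger0_norm (powR_ge0 _ _)).
  rewrite !ler_wpM2r ?invr_ge0 ?powR_ge0 ?(ltW alpha0)//.
  by apply: pseries_norm_le => //; exact: arg_le.
have mE : measurable_fun `]0, t[ (fun s => (derive1 E s / (t - s) `^ alpha)%:E).
  by case/integrableP: (has_caputo_mittag_leffler rho t).2.
have mF n : measurable_fun `]0, t[ (fun s => (F n s)%:E).
  by case/integrableP: (iF n).
have ae1 : {ae mu, forall s, `]0, t[%classic s ->
    (F n s)%:E @[n --> \oo] --> (derive1 E s / (t - s) `^ alpha)%:E}.
  exact: aeW.
have ae2 : {ae mu, forall s n, `]0, t[%classic s ->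
    (`|(F n s)%:E| <= (g s)%:E)%E}.
  by apply: aeW => s n st; rewrite lee_fin Fg.
have [_ _ cv] := dominated_convergence mI mF mE ae1 ig ae2.
have cv1 : \int[mu]_(s in `]0, t[) F n s @[n --> \oo] -->
    \int[mu]_(s in `]0, t[) (derive1 E s / (t - s) `^ alpha).
  apply: fine_cvg; rewrite /Rintegral fineK; first exact: cv.
  exact: integrable_fin_num (has_caputo_mittag_leffler rho t).2.
have cv2 : \int[mu]_(s in `]0, t[) F n s @[n --> \oo] -->
    Gamma (1 - alpha) * (- rho * E t).
  under eq_fun do rewrite intF.
  rewrite /E mittag_lefflerE.
  by do 2 apply: cvgMl_tmp; exact: entire_cvg entire_ml_coef.
exact: (cvg_unique _ cv1 cv2).
Qed.

End mittag_leffler.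

(** * Caputo derivatives of smooth functions *)

Section bounded.
Variable R : realType.

Lemma compact_norm_bounded (T : topologicalType) (A : set T) (K : T -> R) :
  compact A -> (forall x, A x -> {for x, continuous K}) ->
  exists2 C, 0 <= C & forall x, A x -> `|K x| <= C.
Proof.
move=> cA cK.
have : compact (K @` A).
  apply: continuous_compact => //; apply: continuous_in_subspaceT => x.
  by rewrite inE; exact: cK.
move=> /compact_bounded[C [_ /(_ (`|C| + 1))]].
have lC : C < `|C| + 1 by rewrite ltr_pwDr// ler_norm.
move=> /(_ lC) KC; exists (`|C| + 1); first by rewrite addr_ge0.
by move=> x Ax; apply: KC; exists x.
Qed.

Lemma continuous_rV (T : topologicalType) (m : nat) (F : T -> 'rV[R]_m) (x : T) :
  (forall j, {for x, continuous (fun t => F t 0 j)}) -> {for x, continuous F}.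
Proof.
move=> cF A [P FP PA]; rewrite /nbhs/=/fmap/=.
have : \forall t \near x, forall j, P 0 j (F t 0 j).
  by apply: filter_forall => j; exact: cF (FP 0 j).
apply: filterS => t Pt; apply: PA => /= i j.
by rewrite (ord1 i); exact: Pt.
Qed.

Variable m : nat.
Implicit Types (z : 'rV[R]_m) (i j p q : 'I_m) (s u : R).

Lemma updE z i s j : upd z i s 0 j = if j == i then s else z 0 j.
Proof. by rewrite mxE. Qed.

Lemma upd_same z i s : upd z i s 0 i = s.
Proof. by rewrite updE eqxx. Qed.

Lemma upd_other z i s j : j != i -> upd z i s 0 j = z 0 j.
Proof. by rewrite updE => /negbTE ->. Qed.

Lemma upd_upd z i s u : upd (upd z i s) i u = upd z i u.
Proof. by apply/rowP => j; rewrite !updE; case: eqP. Qed.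

Lemma updC z i j s u : i != j -> upd (upd z i s) j u = upd (upd z j u) i s.
Proof.
move=> ij; apply/rowP => k; rewrite !updE; case: eqP => // ->.
by rewrite eq_sym (negbTE ij).
Qed.

Lemma continuous_upd (T : topologicalType) (F : T -> 'rV[R]_m) (h : T -> R) i t :
  {for t, continuous F} -> {for t, continuous h} ->
  {for t, continuous (fun t => upd (F t) i (h t))}.
Proof.
move=> cF ch; apply: continuous_rV => j.
have -> : (fun t => upd (F t) i (h t) 0 j) =
    if j == i then h else (fun t => F t 0 j).
  by apply/funext => u; rewrite updE; case: ifP.
case: ifP => // _.
exact: (cvg_comp F (fun M : 'rV[R]_m => M 0 j) cF
  (@coord_continuous _ _ _ 0 j _)).

Qed.

Lemma derive1_upd (g : 'rV[R]_m -> R) z i s :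
  derive1 (fun u => g (upd z i u)) s = partial i g (upd z i s).
Proof.
rewrite /partial upd_same.
have -> // : (fun u => g (upd (upd z i s) i u)) = (fun u => g (upd z i u)).
by apply/funext => u; rewrite upd_upd.
Qed.

Lemma Ck_derivable_upd k (U : set 'rV[R]_m) (g : 'rV[R]_m -> R) z i s :
  Ck k.+1 U g -> U (upd z i s) -> derivable (fun u => g (upd z i u)) s 1.
Proof.
move=> [_ /(_ i)[dg _]] /dg; rewrite upd_same.
have -> // : (fun u => g (upd (upd z i s) i u)) = (fun u => g (upd z i u)).
by apply/funext => u; rewrite upd_upd.
Qed.

Lemma Ck_continuous k (U : set 'rV[R]_m) (g : 'rV[R]_m -> R) z :
  Ck k U g -> U z -> {for z, continuous g}.
Proof. by case: k => [|k] [cg _]; exact: cg. Qed.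

Lemma Ck_partial k (U : set 'rV[R]_m) (g : 'rV[R]_m -> R) i :
  Ck k.+1 U g -> Ck k U (partial i g).
Proof. by move=> [_ /(_ i)[]]. Qed.

End bounded.

Section smooth_caputo.
Variables (R : realType) (alpha : R) (m : nat).
Hypothesis halpha : 0 < alpha < 1.
Notation mu := (@lebesgue_measure R).
Implicit Types (z : 'rV[R]_m) (p q : 'I_m) (g : 'rV[R]_m -> R)
  (U : set 'rV[R]_m).

Let alpha0 : 0 < alpha. Proof. by case/andP: halpha. Qed.
Let alpha1 : 0 < 1 - alpha. Proof. by rewrite subr_gt0; case/andP: halpha. Qed.

Lemma has_caputo_smooth k U g z p c d : Ck k.+1 U g ->
  (forall s, c <= s <= d -> U (upd z p s)) ->
  has_caputo alpha (fun s => g (upd z p s)) c d.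
Proof.
move=> Cg Us.
have [C C0 gC] : exists2 C, 0 <= C &
    forall s, `[c, d]%classic s -> `|partial p g (upd z p s)| <= C.
  apply: compact_norm_bounded; first exact: segment_compact.
  move=> s; rewrite /= in_itv/= => /Us Uzs.
  apply: continuous_comp.
    by apply: continuous_upd; [exact: cst_continuous|exact: cvg_id].
  exact: Ck_continuous (Ck_partial p Cg) Uzs.
apply: (has_caputo_bound halpha (C := C) (@ltr01 R)) => s csd.
  by apply: (Ck_derivable_upd Cg); apply: Us; case/andP: csd => /ltW -> /ltW ->.
rewrite subrr powRr0 mulr1 derive1_upd gC//= in_itv/=.
by case/andP: csd => /ltW -> /ltW ->.
Qed.

(** The weight (1 - w)^(- alpha) on ]0, 1[, written as a beta kernel. *)
Let omega (w : R) : R := (w - 0) `^ (1 - 1) * (1 - w) `^ (1 - alpha - 1).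

Let omegaE w : omega w = (1 - w) `^ (- alpha).
Proof.
rewrite /omega subrr powRr0 mul1r; congr (_ `^ _); ring.
Qed.

Let omega_ge0 w : 0 <= omega w.
Proof. by rewrite omegaE powR_ge0. Qed.

Let m01 : @measurable _ (measurableTypeR R) `]0, 1[%classic.
Proof. exact: measurable_itvoo. Qed.

Let int_omega : mu.-integrable `]0, 1[ (EFin \o omega).
Proof. exact: integrable_beta. Qed.

Section parameter_integral.
Variables (K K' : R -> R -> R) (c d C : R).
Hypothesis C0 : 0 <= C.
Hypothesis dK : forall s w, c < s < d -> 0 < w < 1 ->
  is_derive s 1 (fun s => K s w) (K' s w).
Hypothesis mK : forall s, c < s < d ->
  measurable_fun (`]0%R, 1%R[%classic : set R) (K s).
Hypothesis mK' : forall s, c < s < d ->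
  measurable_fun (`]0%R, 1%R[%classic : set R) (K' s).
Hypothesis KC : forall s w, c < s < d -> 0 < w < 1 -> `|K s w| <= C.
Hypothesis K'C : forall s w, c < s < d -> 0 < w < 1 -> `|K' s w| <= C.

Definition weighted (s : R) : R := \int[mu]_(w in `]0, 1[) (K s w * omega w).

Let total : R := \int[mu]_(w in `]0, 1[) (C * omega w).

Let int_Comega : mu.-integrable `]0, 1[ (EFin \o (fun w => C * omega w)).
Proof.
by have := integrableZl m01 C int_omega; apply: eq_integrable.
Qed.

Let le_Comega (h : R -> R) w : (forall w, 0 < w < 1 -> `|h w| <= C) ->
  `]0, 1[%classic w -> `|h w * omega w| <= C * omega w.
Proof.
move=> hC; rewrite /= in_itv/= => w01.
by rewrite normrM (ger0_norm (omega_ge0 w)) ler_wpM2r// hC.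
Qed.

Lemma weighted_integrable s : c < s < d ->
  mu.-integrable `]0, 1[ (EFin \o (fun w => K s w * omega w)).
Proof.
move=> csd; apply: (integrable_dominated m01 _ _ int_Comega).
  apply: measurable_funM; first exact: mK.
  by apply/measurable_EFinP; case/integrableP: int_omega.
by move=> w; apply: le_Comega => v; exact: KC.
Qed.

Let norm_le_total (h : R -> R) :
  mu.-integrable `]0, 1[ (EFin \o (fun w => h w * omega w)) ->
  (forall w, 0 < w < 1 -> `|h w| <= C) ->
  `|\int[mu]_(w in `]0, 1[) (h w * omega w)| <= total.
Proof.
move=> inth hC; apply: (le_trans (le_normr_Rintegral m01 inth)).
apply: le_Rintegral => //; first exact: integrable_norm inth.
by move=> w; exact: le_Comega.
Qed.

Lemma weighted_le : forall s, c < s < d -> `|weighted s| <= total.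
Proof.
move=> s csd; apply: norm_le_total; first exact: weighted_integrable.
by move=> w; exact: KC.
Qed.

Let f s w := K s w * omega w.

Let derf s w : c < s < d -> 0 < w < 1 ->
  is_derive s 1 (f ^~ w) (K' s w * omega w).
Proof.
move=> csd w01; have h := is_deriveZ (omega w) (dK csd w01).
rewrite mulrC.
have -> // : f^~ w = omega w \*: (fun s => K s w).
by apply/funext => u; rewrite /f mulrC.
Qed.

Let parf s w : c < s < d -> 0 < w < 1 -> partial1of2 f s w = K' s w * omega w.
Proof.
move=> csd w01; rewrite partial1of2E.
exact: (@derive_val _ _ _ _ _ _ _ (derf csd w01)).
Qed.

Lemma weighted_derivable s : c < s < d ->
  derivable weighted s 1 /\ `|derive1 weighted s| <= total.
Proof.
move=> csd.
have Is : `]c, d[%classic s by rewrite /= in_itv.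
have intf x : `]c, d[%classic x -> mu.-integrable `]0, 1[ (EFin \o f x).
  by rewrite /= in_itv/=; exact: weighted_integrable.
have der1 x w : `]c, d[%classic x -> `]0, 1[%classic w -> derivable (f ^~ w) x 1.
  by rewrite /= !in_itv/= => cxd w01; have [] := derf cxd w01.
have G0 w : 0 <= C * omega w by rewrite mulr_ge0.
have Gub x w : `]c, d[%classic x -> `]0, 1[%classic w ->
    `|partial1of2 f x w| <= C * omega w.
  rewrite /= !in_itv/= => cxd w01; rewrite parf//.
  by apply: le_Comega => [v|]; [exact: K'C|rewrite /= in_itv].
split.
  exact: (derivable_under_integral m01 Is intf der1 G0 int_Comega Gub).
have -> : derive1 weighted s = \int[mu]_(w in `]0, 1[) (K' s w * omega w).
  rewrite (differentiation_under_integral m01 Is intf der1 G0 int_Comega Gub).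
  by apply: eq_Rintegral => w; rewrite inE/= in_itv/=; exact: parf.
apply: norm_le_total; last by move=> w; exact: K'C.
apply: (integrable_dominated m01 _ _ int_Comega).
  apply: measurable_funM; first exact: mK'.
  by apply/measurable_EFinP; case/integrableP: int_omega.
by move=> w; apply: le_Comega => v; exact: K'C.
Qed.

Lemma has_caputo_weighted : has_caputo alpha weighted c d.
Proof.
apply: (has_caputo_bound halpha (C := total) (@ltr01 R)) => s csd.
  by have [] := weighted_derivable csd.
by rewrite subrr powRr0 mulr1; have [] := weighted_derivable csd.
Qed.

(** The derivative of the factor (s - c)^(1 - alpha) blows up at c, but only
   like (s - c)^(- alpha), which a beta kernel still dominates. *)
Lemma has_caputo_powR_weighted :
  has_caputo alpha (fun s => (s - c) `^ (1 - alpha) * weighted s) c d.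
Proof.
have dp s : c < s < d -> is_derive s 1
    (fun s => (s - c) `^ (1 - alpha) * weighted s)
    ((s - c) `^ (1 - alpha) * derive1 weighted s +
     weighted s * ((1 - alpha) * (s - c) `^ (1 - alpha - 1))).
  move=> csd; have [cs sd] := andP csd.
  have sc0 : 0 < s - c by rewrite subr_gt0.
  have [dw _] := weighted_derivable csd.
  have d1 : is_derive s 1 (fun s => s - c) 1.
    by have := is_deriveB (is_derive_id s 1) (is_derive_cst c s 1); rewrite subr0.
  have d2 := @is_derive1_comp R _ (fun u => u - c) _ _ _
    (is_derive1_powR (1 - alpha) sc0) d1.
  have d3 : is_derive s 1 weighted (derive1 weighted s).
    by apply: DeriveDef => //; rewrite derive1E.
  have := is_deriveM d2 d3; rewrite mulr1; exact.
apply: (has_caputo_bound halpha (C := ((d - c) + (1 - alpha)) * total) alpha1).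
  by move=> s /dp[].
move=> s csd; have [cs sd] := andP csd.
have sc0 : 0 < s - c by rewrite subr_gt0.
rewrite derive1E (@derive_val _ _ _ _ _ _ _ (dp s csd)).
have [_ dw] := weighted_derivable csd.
have pE : (s - c) `^ (1 - alpha) = (s - c) * (s - c) `^ (1 - alpha - 1).
  by rewrite mulr_powRB1// ltW.
apply: (le_trans (ler_normD _ _)).
rewrite !normrM pE normrM !(ger0_norm (powR_ge0 _ _)).
rewrite (ger0_norm (ltW sc0)) (ger0_norm (ltW alpha1)).
have -> : ((d - c) + (1 - alpha)) * total * (s - c) `^ (1 - alpha - 1) =
  (d - c) * (s - c) `^ (1 - alpha - 1) * total +
  total * ((1 - alpha) * (s - c) `^ (1 - alpha - 1)) by ring.
apply: lerD; last first.
  by rewrite ler_wpM2r ?weighted_le// mulr_ge0 ?powR_ge0// ltW.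
rewrite ler_pM ?mulr_ge0 ?powR_ge0 ?(ltW sc0)//.
by rewrite ler_wpM2r ?powR_ge0// lerD2r ltW.
Qed.

End parameter_integral.

(** Continuity on the compact box [c, d] x [0, 1] supplies the bounds and the
   measurability that differentiation under the integral requires. *)
Section box.
Variables (K K' : R -> R -> R) (c d : R).
Hypothesis cd : c < d.
Let A := (`[c, d] `*` `[0, 1])%classic : set (R * R).
Hypothesis dK : forall s w, c < s < d -> 0 < w < 1 ->
  is_derive s 1 (fun s => K s w) (K' s w).
Hypothesis cK : forall x, A x -> {for x, continuous (fun x => K x.1 x.2)}.
Hypothesis cK' : forall x, A x -> {for x, continuous (fun x => K' x.1 x.2)}.

Lemma measurable_slice (H : R -> R -> R) s :
  (forall x, A x -> {for x, continuous (fun x => H x.1 x.2)}) ->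
  c < s < d -> measurable_fun (`]0%R, 1%R[%classic : set R) (H s).
Proof.
move=> cH csd; apply: open_continuous_measurable_fun => [|w].
  exact: interval_open.
rewrite inE/= in_itv/= => /andP[/ltW w0 /ltW w1].
have Asw : A (s, w).
  by split; rewrite /= in_itv/= ?w0//; case/andP: csd => /ltW -> /ltW ->.
apply: (cvg_comp (fun w => (s, w)) (fun x => H x.1 x.2) _ (cH _ Asw)).
exact: (cvg_pair (cvg_cst s) cvg_id).
Qed.

Lemma box_bounded : exists C, [/\ 0 <= C,
  (forall s w, c < s < d -> 0 < w < 1 -> `|K s w| <= C) &
  (forall s w, c < s < d -> 0 < w < 1 -> `|K' s w| <= C)].
Proof.
have cA : compact A by apply: compact_setX; exact: segment_compact.
have [C C0 KC] := compact_norm_bounded cA cK.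
have [C' C'0 K'C] := compact_norm_bounded cA cK'.
have inA s w : c < s < d -> 0 < w < 1 -> A (s, w).
  move=> /andP[/ltW cs /ltW sd] /andP[/ltW w0 /ltW w1].
  by split; rewrite /= in_itv/= ?cs ?w0.
exists (C + C'); split; first exact: addr_ge0.
- by move=> s w cs w01; rewrite (le_trans (KC _ (inA _ _ cs w01)))// lerDl.
- by move=> s w cs w01; rewrite (le_trans (K'C _ (inA _ _ cs w01)))// lerDr.
Qed.

Lemma box_integrable s : c < s < d ->
  mu.-integrable `]0, 1[ (EFin \o (fun w => K s w * omega w)).
Proof.
have [C [C0 KC _]] := box_bounded.
by apply: (weighted_integrable _ KC) => u; exact: measurable_slice.
Qed.

Lemma box_has_caputo : has_caputo alpha (weighted K) c d.
Proof.
have [C [C0 KC K'C]] := box_bounded.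
by apply: (has_caputo_weighted C0 dK _ _ KC K'C) => u; exact: measurable_slice.
Qed.

Lemma box_has_caputo_powR :
  has_caputo alpha (fun s => (s - c) `^ (1 - alpha) * weighted K s) c d.
Proof.
have [C [C0 KC K'C]] := box_bounded.
by apply: (has_caputo_powR_weighted C0 dK _ _ KC K'C) => u;
  exact: measurable_slice.
Qed.

End box.

(** Rescaling the segment of integration to ]0, 1[ turns the moving endpoint
   into a parameter of a bounded integrand. *)
Lemma caputo_rescaled g z q e v : e < v ->
  mu.-integrable `]0, 1[ (EFin \o
    (fun w => partial q g (upd z q ((v - e) * w + e)) * omega w)) ->
  has_caputo alpha (fun u => g (upd z q u)) e v ->
  caputo alpha e (fun u => g (upd z q u)) v =
  (Gamma (1 - alpha))^-1 * ((v - e) `^ (1 - alpha) *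
    \int[mu]_(w in `]0, 1[) (partial q g (upd z q ((v - e) * w + e)) * omega w)).
Proof.
move=> ev iK [_ ig]; have ev0 : 0 < v - e by rewrite subr_gt0.
rewrite caputoE//; apply: (congr1 ( *%R _)).
rewrite (Rintegral_affine e ev0 (measurable_itvoo e v) ig).
have -> : (fun w => (v - e) * w + e) @^-1` `]e, v[ = `]0, 1[%classic.
  by rewrite preimage_affine_itv// subrr mul0r divff// gt_eqF.
rewrite -(mulr_powRB1 (ltW ev0) alpha1) -mulrA; apply: (congr1 ( *%R _)).
rewrite -(RintegralZl _ m01 iK); apply: eq_Rintegral => w.
rewrite inE/= in_itv/= => /andP[w0 w1].
rewrite derive1_upd omegaE.
have -> : v - ((v - e) * w + e) = (v - e) * (1 - w) by ring.
rewrite powRM ?(ltW ev0) ?subr_ge0 ?(ltW w1)// powRN invfM.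
have -> : 1 - alpha - 1 = - alpha by ring.
by rewrite powRN mulrCA.
Qed.

(** Differentiating twice in the same variable: after rescaling, the inner
   derivative is (s - c)^(1 - alpha) times a weighted integral over the segment
   from c to s. *)
Lemma has_caputo_iterated_same k U g z p c d : Ck k.+2 U g ->
  (forall s, c <= s <= d -> U (upd z p s)) ->
  has_caputo alpha (fun s => caputo alpha c (fun u => g (upd z p u)) s) c d.
Proof.
move=> Cg inU; have [dc|cd] := leP d c; first exact: has_caputo_empty.
pose Q (x : R * R) := upd z p ((x.1 - c) * x.2 + c).
have cQ x : {for x, continuous Q}.
  apply: continuous_upd; first exact: cvg_cst.
  apply: cvgD; last exact: cvg_cst.
  apply: cvgM; last exact: cvg_snd.
  by apply: cvgB; [exact: cvg_fst|exact: cvg_cst].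
have QU s w : c <= s <= d -> 0 <= w <= 1 -> U (Q (s, w)).
  move=> /andP[cs sd] /andP[w0 w1]; apply: inU; rewrite /= lerDr.
  have sc0 : 0 <= s - c by rewrite subr_ge0.
  rewrite mulr_ge0//= (le_trans _ sd)// -lerBrDr.
  by rewrite ler_piMr.
pose h := partial p g.
have Ch : Ck k.+1 U h by exact: Ck_partial.
have Ch' : Ck k U (partial p h) by exact: Ck_partial.
have cont (f : 'rV[R]_m -> R) j : Ck j U f ->
    forall x, (`[c, d] `*` `[0, 1])%classic x -> {for x, continuous (f \o Q)}.
  move=> Cf [s w] [/=]; rewrite !in_itv/= => csd w01.
  exact: (cvg_comp Q f (cQ _) (Ck_continuous Cf (QU _ _ csd w01))).
pose K s w := h (Q (s, w)).
pose K' s w := w * partial p h (Q (s, w)).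
have dK s w : c < s < d -> 0 < w < 1 ->
    is_derive s 1 (fun s => K s w) (K' s w).
  move=> /andP[/ltW cs /ltW sd] /andP[/ltW w0 /ltW w1].
  have QUsw : U (Q (s, w)) by apply: QU; rewrite ?cs ?w0.
  have d1 : is_derive s 1 (fun s => w * (s - c) + c) w.
    have := is_deriveD (is_deriveZ w (is_deriveB (is_derive_id s 1)
      (is_derive_cst c s 1))) (is_derive_cst c s 1).
    by rewrite subr0 addr0 /GRing.scale/= mulr1.
  have d2 : is_derive (w * (s - c) + c) 1 (fun u => h (upd z p u))
      (partial p h (Q (s, w))).
    rewrite /Q/= mulrC -derive1_upd; apply: DeriveDef; last by rewrite derive1E.
    by apply: (Ck_derivable_upd Ch); move: QUsw; rewrite /Q/= mulrC.
  have := @is_derive1_comp R _ (fun s => w * (s - c) + c) _ _ _ d2 d1.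
  rewrite /K' mulrC.
  have -> // : (fun u => h (upd z p u)) \o (fun s => w * (s - c) + c) =
      (fun s => K s w).
  by apply/funext => u; rewrite /K /Q/= mulrC.
have cK : forall x, (`[c, d] `*` `[0, 1])%classic x ->
    {for x, continuous (fun x => K x.1 x.2)}.
  move=> x Ax; have := cont _ _ Ch x Ax.
  by have -> // : h \o Q = (fun x => K x.1 x.2) by apply/funext => -[].
have cK' : forall x, (`[c, d] `*` `[0, 1])%classic x ->
    {for x, continuous (fun x => K' x.1 x.2)}.
  move=> x Ax; apply: cvgM; first exact: cvg_snd.
  have := cont _ _ Ch' x Ax.
  by have -> // : partial p h \o Q = (fun x => partial p h (Q (x.1, x.2)))
    by apply/funext => -[].
have := has_caputoZ (Gamma (1 - alpha))^-1 (box_has_caputo_powR dK cK cK').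
apply: eq_has_caputo => s csd; have [cs sd] := andP csd.
rewrite (caputo_rescaled cs)//.
  exact: (box_integrable cK cK' csd).
apply: (has_caputo_smooth Cg) => u /andP[cu us]; apply: inU.
by rewrite cu (le_trans us)// ltW.
Qed.

(** Differentiating in two distinct variables: the endpoint of the inner
   integral stays fixed, so the power in front of the weighted integral is
   constant. *)
Lemma has_caputo_iterated_other k U g z p q c d e : Ck k.+2 U g -> p != q ->
  (forall s u, c <= s <= d -> e <= u <= z 0 q -> U (upd (upd z p s) q u)) ->
  has_caputo alpha
    (fun s => caputo alpha e (fun u => g (upd (upd z p s) q u)) (z 0 q)) c d.
Proof.
move=> Cg pq inU; have [dc|cd] := leP d c; first exact: has_caputo_empty.
set v := z 0 q in inU *; have [ve|ev] := leP v e.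
  have : has_caputo alpha (fun=> 0) c d.
    apply: (has_caputo_bound halpha (C := 0) (@ltr01 R)) => s _ //.
    by rewrite mul0r derive1_cst normr0.
  by apply: eq_has_caputo => s _; rewrite caputo_empty.
pose Q (x : R * R) := upd (upd z p x.1) q ((v - e) * x.2 + e).
have cQ x : {for x, continuous Q}.
  apply: continuous_upd.
    by apply: continuous_upd; [exact: cvg_cst|exact: cvg_fst].
  apply: cvgD; last exact: cvg_cst.
  by apply: cvgM; [exact: cvg_cst|exact: cvg_snd].
have QU s w : c <= s <= d -> 0 <= w <= 1 -> U (Q (s, w)).
  move=> csd /andP[w0 w1]; apply: inU; rewrite //= lerDr.
  have ve0 : 0 <= v - e by rewrite subr_ge0 ltW.
  by rewrite mulr_ge0//= -lerBrDr ler_piMr.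
pose h := partial q g.
have Ch : Ck k.+1 U h by exact: Ck_partial.
have Ch' : Ck k U (partial p h) by exact: Ck_partial.
have cont (f : 'rV[R]_m -> R) j : Ck j U f ->
    forall x, (`[c, d] `*` `[0, 1])%classic x -> {for x, continuous (f \o Q)}.
  move=> Cf [s w] [/=]; rewrite !in_itv/= => csd w01.
  exact: (cvg_comp Q f (cQ _) (Ck_continuous Cf (QU _ _ csd w01))).
pose K s w := h (Q (s, w)).
pose K' s w := partial p h (Q (s, w)).
have dK s w : c < s < d -> 0 < w < 1 ->
    is_derive s 1 (fun s => K s w) (K' s w).
  move=> /andP[/ltW cs /ltW sd] /andP[/ltW w0 /ltW w1].
  have : U (Q (s, w)) by apply: QU; rewrite ?cs ?w0.
  have QE u : Q (u, w) = upd (upd z q ((v - e) * w + e)) p u by exact: updC.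
  have -> : (fun s => K s w) = (fun s => h (upd (upd z q ((v - e) * w + e)) p s)).
    by apply/funext => u; rewrite /K QE.
  rewrite /K' QE => QUsw.
  rewrite -derive1_upd; apply: DeriveDef; last by rewrite derive1E.
  exact: (Ck_derivable_upd Ch).
have cK : forall x, (`[c, d] `*` `[0, 1])%classic x ->
    {for x, continuous (fun x => K x.1 x.2)}.
  move=> x Ax; have := cont _ _ Ch x Ax.
  by have -> // : h \o Q = (fun x => K x.1 x.2) by apply/funext => -[].
have cK' : forall x, (`[c, d] `*` `[0, 1])%classic x ->
    {for x, continuous (fun x => K' x.1 x.2)}.
  move=> x Ax; have := cont _ _ Ch' x Ax.
  by have -> // : partial p h \o Q = (fun x => K' x.1 x.2) by apply/funext => -[].
have := has_caputoZ ((Gamma (1 - alpha))^-1 * (v - e) `^ (1 - alpha))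
  (box_has_caputo dK cK cK').
apply: eq_has_caputo => s csd; have [cs sd] := andP csd.
rewrite (caputo_rescaled ev) -?mulrA//.
  exact: (box_integrable cK cK' csd).
apply: (has_caputo_smooth Cg) => u uv; apply: inU => //.
by rewrite !ltW.
Qed.

End smooth_caputo.

(** * The Euler-Lagrange expressions *)

(** The algebra common to the expressions, with the derivatives as unknowns: d
   stands for the x derivative, T for the time derivative, X j and Z j for the
   iterated ones, D for the y derivative. *)
Section expression_algebra.
Variables (R : realType) (n : nat).

Lemma expression_add (d du dv T Tu Tv : R) (Y Y2 X Xu Xv Z Zu Zv : 'I_n -> R) :
  d = du + dv -> T = Tu + Tv -> (forall j, X j = Xu j + Xv j) ->
  (forall j, Z j = Zu j + Zv j) ->
  d - (T + \sum_j Y j * X j + \sum_j Y2 j * Z j) =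
  (du - (Tu + \sum_j Y j * Xu j + \sum_j Y2 j * Zu j)) +
  (dv - (Tv + \sum_j Y j * Xv j + \sum_j Y2 j * Zv j)).
Proof.
move=> -> -> XE ZE.
under eq_bigr do rewrite XE mulrDr.
under [X in _ - (_ + X)]eq_bigr do rewrite ZE mulrDr.
by rewrite !big_split/=; ring.
Qed.

Lemma expression_mul (k c D d du T : R) (Y Y2 X Xu Z Zu : 'I_n -> R) :
  d = k * du -> T = D * c -> (forall j, X j = k * Xu j) ->
  (forall j, Z j = k * Zu j) ->
  d - (T + \sum_j Y j * X j + \sum_j Y2 j * Z j) =
  k * (du - \sum_j Y j * Xu j - \sum_j Y2 j * Zu j) - c * D.
Proof.
move=> -> -> XE ZE.
under eq_bigr do rewrite XE mulrCA.
under [X in _ - (_ + X)]eq_bigr do rewrite ZE mulrCA.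
by rewrite -!mulr_sumr; ring.
Qed.

Lemma expression_eq (d d' T T' : R) (Y Y2 X X' Z Z' : 'I_n -> R) :
  d = d' -> T = T' -> (forall j, X j = X' j) -> (forall j, Z j = Z' j) ->
  d - (T + \sum_j Y j * X j + \sum_j Y2 j * Z j) =
  d' - (T' + \sum_j Y j * X' j + \sum_j Y2 j * Z' j).
Proof. by move=> -> -> /funext -> /funext ->. Qed.

Lemma expression_multiplier (d T k df S S2 c D : R) :
  (d - T) + (k * (df - S - S2) - c * D) =
  d + k * df - T - k * S - k * S2 - c * D.
Proof. by ring. Qed.

Lemma expression_discount (d T k df S S2 c D E rho d1 D1 S1 S12 : R) :
  E * (d1 - S1 - S12) - - rho * E * D1 = d - T ->
  d + k * df - T - k * S - k * S2 - c * D =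
  E * (d1 + rho * D1 - S1 - S12) + k * (df - S - S2) - c * D.
Proof. by move=> H; rewrite -expression_multiplier -H; ring. Qed.

End expression_algebra.

Section caputo_regular.
Variables (R : realType) (alpha : R) (n : nat) (M : topologicalType).
Variables (a b : 'rV[R]_n) (phi : chart R n M).
Hypothesis halpha : 0 < alpha < 1.
Implicit Types (u v : R -> 'rV[R]_n -> 'rV[R]_n -> R) (x y : 'rV[R]_n) (t : R).
Implicit Types (e : R -> R).

Notation Dx := (@Dx R n alpha a).
Notation Dy := (@Dy R n alpha b).
Notation EL := (@EL R n alpha a b).
Notation adm := (admissible a b phi).

(** Integrability of all first and iterated Caputo derivatives that occur in the
   Euler-Lagrange expression of u. The y derivative is asked at every point over
   the chart: the iterated ones evaluate it along segments through the point. *)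
Record caputo_regular u : Prop := CaputoRegular {
  regular_y : forall i t x y, 0 < t -> cod phi x ->
    has_caputo alpha (fun s => u t x (upd y i s)) (b 0 i) (y 0 i) ;
  regular_x : forall i t x y, adm t x y ->
    has_caputo alpha (fun s => u t (upd x i s) y) (a 0 i) (x 0 i) ;
  regular_ty : forall i t x y, adm t x y ->
    has_caputo alpha (fun s => Dy i u s x y) 0 t ;
  regular_xy : forall i j t x y, adm t x y ->
    has_caputo alpha (fun s => Dy i u t (upd x j s) y) (a 0 j) (x 0 j) ;
  regular_yy : forall i j t x y, adm t x y ->
    has_caputo alpha (fun s => Dy i u t x (upd y j s)) (b 0 j) (y 0 j) }.

Lemma admissible_upd t x y i s : adm t x y -> a 0 i < s < x 0 i ->
  cod phi (upd x i s).
Proof.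
by move=> [_ _ /(_ i)[_ h] _] /andP[/ltW as' /ltW sx]; apply: h; rewrite as'.
Qed.

Lemma Dy_add u v i t x y : caputo_regular u -> caputo_regular v ->
  0 < t -> cod phi x ->
  Dy i (fun t x y => u t x y + v t x y) t x y = Dy i u t x y + Dy i v t x y.
Proof.
move=> ru rv t0 px.
exact: (caputoD halpha (regular_y ru i y t0 px) (regular_y rv i y t0 px)).
Qed.

Lemma Dy_mul e u i t x y : caputo_regular u -> 0 < t -> cod phi x ->
  Dy i (fun t x y => e t * u t x y) t x y = e t * Dy i u t x y.
Proof. by move=> ru t0 px; exact: (caputoZ halpha _ (regular_y ru i y t0 px)). Qed.

Lemma EL_add u v i t x y y2 : caputo_regular u -> caputo_regular v ->
  adm t x y ->
  EL (fun t x y => u t x y + v t x y) i t x y y2 =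
  EL u i t x y y2 + EL v i t x y y2.
Proof.
move=> ru rv h; have [t0 px _ _] := h.
have dx : Dx i (fun t x y => u t x y + v t x y) t x y =
    Dx i u t x y + Dx i v t x y.
  exact: (caputoD halpha (regular_x ru i h) (regular_x rv i h)).
set w := Dy i (fun t x y => u t x y + v t x y).
have wt : Dt alpha w t x y = Dt alpha (Dy i u) t x y + Dt alpha (Dy i v) t x y.
  rewrite /Dt -(caputoD halpha (regular_ty ru i h) (regular_ty rv i h)).
  by apply: (eq_caputo halpha) => s /andP[s0 _]; exact: (Dy_add i y ru rv s0 px).
have wx j : Dx j w t x y = Dx j (Dy i u) t x y + Dx j (Dy i v) t x y.
  rewrite /Dx -(caputoD halpha (regular_xy ru i j h) (regular_xy rv i j h)).
  apply: (eq_caputo halpha) => s sx.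
  exact: (Dy_add i y ru rv t0 (admissible_upd h sx)).
have wy j : Dy j w t x y = Dy j (Dy i u) t x y + Dy j (Dy i v) t x y.
  rewrite /Dy -(caputoD halpha (regular_yy ru i j h) (regular_yy rv i j h)).
  by apply: (eq_caputo halpha) => s _; exact: (Dy_add i _ ru rv t0 px).
exact: (expression_add _ _ dx wt wx wy).
Qed.

Lemma Dy_time u i t s x y : (forall t t' x y, u t x y = u t' x y) ->
  Dy i u t x y = Dy i u s x y.
Proof. by move=> uE; apply: (eq_caputo halpha) => v _; exact: uE. Qed.

(** A factor depending on time only passes through the derivatives in x and y,
   while the time derivative falls on it alone. *)
Lemma EL_mul e u i t x y y2 : caputo_regular u ->
  (forall t t' x y, u t x y = u t' x y) ->
  has_caputo alpha e 0 t -> adm t x y ->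
  EL (fun t x y => e t * u t x y) i t x y y2 =
  e t * (Dx i u t x y - \sum_j y 0 j * Dx j (Dy i u) t x y
         - \sum_j y2 0 j * Dy j (Dy i u) t x y)
  - caputo alpha 0 e t * Dy i u t x y.
Proof.
move=> ru uE oke h; have [t0 px _ _] := h.
have dx : Dx i (fun t x y => e t * u t x y) t x y = e t * Dx i u t x y.
  exact: (caputoZ halpha _ (regular_x ru i h)).
set w := Dy i (fun t x y => e t * u t x y).
have wt : Dt alpha w t x y = Dy i u t x y * caputo alpha 0 e t.
  rewrite /Dt -(caputoZ halpha _ oke).
  apply: (eq_caputo halpha) => s /andP[s0 _].
  by rewrite (Dy_time i t s x y uE) mulrC; exact: (Dy_mul e i y ru s0 px).
have wx j : Dx j w t x y = e t * Dx j (Dy i u) t x y.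
  rewrite /Dx -(caputoZ halpha _ (regular_xy ru i j h)).
  apply: (eq_caputo halpha) => s sx.
  exact: (Dy_mul e i y ru t0 (admissible_upd h sx)).
have wy j : Dy j w t x y = e t * Dy j (Dy i u) t x y.
  rewrite /Dy -(caputoZ halpha _ (regular_yy ru i j h)).
  by apply: (eq_caputo halpha) => s _; exact: (Dy_mul e i _ ru t0 px).
exact: (expression_mul _ _ dx wt wx wy).
Qed.

Lemma regular_mul e u : caputo_regular u ->
  (forall t t' x y, u t x y = u t' x y) ->
  (forall t, 0 < t -> has_caputo alpha e 0 t) ->
  caputo_regular (fun t x y => e t * u t x y).
Proof.
move=> ru uE oke; split.
- by move=> i t x y t0 px; apply: has_caputoZ; exact: regular_y.
- by move=> i t x y h; apply: has_caputoZ; exact: regular_x h.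
- move=> i t x y h; have [t0 px _ _] := h.
  apply: eq_has_caputo (has_caputoZ (Dy i u t x y) (oke t t0)) => s /andP[s0 _].
  by rewrite (Dy_time i t s x y uE) mulrC (Dy_mul e i y ru s0 px).
- move=> i j t x y h; have [t0 px _ _] := h.
  apply: eq_has_caputo (has_caputoZ (e t) (regular_xy ru i j h)) => s sx.
  by rewrite (Dy_mul e i y ru t0 (admissible_upd h sx)).
- move=> i j t x y h; have [t0 px _ _] := h.
  apply: eq_has_caputo (has_caputoZ (e t) (regular_yy ru i j h)) => s _.
  by rewrite (Dy_mul e i _ ru t0 px).
Qed.

Lemma eq_Dy u v i t x y : (forall x y, u t x y = v t x y) ->
  Dy i u t x y = Dy i v t x y.
Proof. by move=> uv; apply: (eq_caputo halpha) => s _; exact: uv. Qed.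

Lemma eq_EL u v i t x y y2 : (forall t x y, 0 < t -> u t x y = v t x y) ->
  0 < t -> EL u i t x y y2 = EL v i t x y y2.
Proof.
move=> uv t0.
have DyE s x' y' : 0 < s -> Dy i u s x' y' = Dy i v s x' y'.
  by move=> s0; apply: eq_Dy => x'' y''; exact: uv.
have DxE : Dx i u t x y = Dx i v t x y.
  by apply: (eq_caputo halpha) => s _; exact: uv.
have DtE : Dt alpha (Dy i u) t x y = Dt alpha (Dy i v) t x y.
  by apply: (eq_caputo halpha) => s /andP[s0 _]; exact: DyE.
have DxyE j : Dx j (Dy i u) t x y = Dx j (Dy i v) t x y.
  by apply: (eq_caputo halpha) => s _; exact: DyE.
have DyyE j : Dy j (Dy i u) t x y = Dy j (Dy i v) t x y.
  by apply: (eq_caputo halpha) => s _; exact: DyE.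
exact: (expression_eq _ _ DxE DtE DxyE DyyE).
Qed.

Lemma eq_regular u v : (forall t x y, 0 < t -> u t x y = v t x y) ->
  caputo_regular u -> caputo_regular v.
Proof.
move=> uv ru.
have DyE i s x' y' : 0 < s -> Dy i u s x' y' = Dy i v s x' y'.
  by move=> s0; apply: eq_Dy => x'' y''; exact: uv.
split.
- move=> i t x y t0 px; apply: eq_has_caputo (regular_y ru i y t0 px) => s _.
  exact: uv.
- move=> i t x y h; have [t0 _ _ _] := h.
  by apply: eq_has_caputo (regular_x ru i h) => s _; exact: uv.
- move=> i t x y h; apply: eq_has_caputo (regular_ty ru i h) => s /andP[s0 _].
  exact: DyE.
- move=> i j t x y h; have [t0 _ _ _] := h.
  by apply: eq_has_caputo (regular_xy ru i j h) => s _; exact: DyE.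
- move=> i j t x y h; have [t0 _ _ _] := h.
  by apply: eq_has_caputo (regular_yy ru i j h) => s _; exact: DyE.
Qed.

End caputo_regular.

(** * Smooth functions on the jet bundle *)

Section stacked_coordinates.
Variables (R : realType) (n : nat).
Implicit Types (x y : 'rV[R]_n) (t s : R) (i : 'I_n).

Definition stack t x y : 'rV[R]_(1 + (n + n)) := row_mx (const_mx t) (row_mx x y).

Definition t_index : 'I_(1 + (n + n)) := lshift (n + n) ord0.
Definition x_index i : 'I_(1 + (n + n)) := rshift 1 (lshift n i).
Definition y_index i : 'I_(1 + (n + n)) := rshift 1 (rshift n i).

Lemma stack_t t x y : stack t x y 0 t_index = t.
Proof. by rewrite /stack /t_index row_mxEl mxE. Qed.

Lemma stack_x t x y i : stack t x y 0 (x_index i) = x 0 i.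
Proof. by rewrite /stack /x_index row_mxEr row_mxEl. Qed.

Lemma stack_y t x y i : stack t x y 0 (y_index i) = y 0 i.
Proof. by rewrite /stack /y_index !row_mxEr. Qed.

Lemma stack_rec (z z' : 'rV[R]_(1 + (n + n))) : z 0 t_index = z' 0 t_index ->
  (forall i, z 0 (x_index i) = z' 0 (x_index i)) ->
  (forall i, z 0 (y_index i) = z' 0 (y_index i)) -> z = z'.
Proof.
move=> zt zx zy; apply/rowP => j.
case: (split_ordP j) => [k ->|k ->]; first by rewrite (ord1 k).
by case: (split_ordP k) => [i ->|i ->]; [exact: zx|exact: zy].
Qed.

Lemma neq_tx i : (t_index == x_index i) = false.
Proof. by apply/negbTE; rewrite -val_eqE. Qed.

Lemma neq_ty i : (t_index == y_index i) = false.
Proof. by apply/negbTE; rewrite -val_eqE. Qed.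

Lemma neq_xy i j : (x_index i == y_index j) = false.
Proof.
apply/negbTE; rewrite -val_eqE/= eqSS neq_ltn.
by rewrite (leq_trans (ltn_ord i))// leq_addr.
Qed.

Lemma eq_xx i j : (x_index i == x_index j) = (i == j).
Proof. by rewrite -!val_eqE/= eqSS. Qed.

Lemma eq_yy i j : (y_index i == y_index j) = (i == j).
Proof. by rewrite -!val_eqE/= eqSS eqn_add2l. Qed.

Lemma upd_stack_t t x y s : upd (stack t x y) t_index s = stack s x y.
Proof.
by apply: stack_rec => [|i|i]; rewrite updE ?eqxx ?stack_t// ?stack_x ?stack_y
  eq_sym ?neq_tx ?neq_ty.
Qed.

Lemma upd_stack_x t x y i s :
  upd (stack t x y) (x_index i) s = stack t (upd x i s) y.
Proof.
apply: stack_rec => [|j|j]; rewrite updE ?stack_t ?stack_x ?stack_y.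
- by rewrite neq_tx.
- by rewrite eq_xx updE.
- by rewrite eq_sym neq_xy.
Qed.

Lemma upd_stack_y t x y i s :
  upd (stack t x y) (y_index i) s = stack t x (upd y i s).
Proof.
apply: stack_rec => [|j|j]; rewrite updE ?stack_t ?stack_x ?stack_y.
- by rewrite neq_ty.
- by rewrite neq_xy.
- by rewrite eq_yy updE.
Qed.

End stacked_coordinates.

Section smooth_regular.
Variables (R : realType) (alpha : R) (n : nat) (M : topologicalType).
Variables (A : set (chart R n M)) (a b : 'rV[R]_n) (phi : chart R n M).
Hypothesis halpha : 0 < alpha < 1.
Hypothesis hphi : A phi.

(** The segments of integration of an admissible point stay over the chart, and
   the y coordinates are unconstrained. *)
Lemma smooth_regular (G : Jet A alpha -> R) : smooth_jet G ->
  caputo_regular alpha a b phi (loc phi G).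
Proof.
move=> /(_ _ hphi).
set U := [set z | _]; set g := (fun z => loc phi G _ _ _) => sg.
have gE t x y : g (stack t x y) = loc phi G t x y.
  by rewrite /g /stack row_mxKl row_mxKr row_mxKl row_mxKr mxE.
have UE t x y : cod phi x -> U (stack t x y).
  by rewrite /U/= /stack row_mxKr row_mxKl.
have DyE i t x y : Dy alpha b i (loc phi G) t x y =
    caputo alpha (b 0 i) (fun s => g (upd (stack t x y) (y_index i) s))
      (stack t x y 0 (y_index i)).
  rewrite /Dy stack_y; apply: (eq_caputo halpha) => s _.
  by rewrite upd_stack_y gE.
split.
- move=> i t x y t0 px.
  have := @has_caputo_smooth _ _ _ halpha 0 U g (stack t x y) (y_index i)
    (b 0 i) (y 0 i) (sg 1%N).
  move=> H; apply: eq_has_caputo (H _) => s _; first by rewrite upd_stack_y gE.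
  by rewrite upd_stack_y; exact: UE.
- move=> i t x y [t0 px /(_ i)[_ ax] _].
  have := @has_caputo_smooth _ _ _ halpha 0 U g (stack t x y) (x_index i)
    (a 0 i) (x 0 i) (sg 1%N).
  move=> H; apply: eq_has_caputo (H _) => s sx; first by rewrite upd_stack_x gE.
  by rewrite upd_stack_x; apply: UE; exact: ax.
- move=> i t x y [t0 px _ _].
  have := @has_caputo_iterated_other _ _ _ halpha 0 U g (stack t x y) (t_index n)
    (y_index i) 0 t (b 0 i) (sg 2%N).
  rewrite neq_ty => /(_ isT) H; apply: eq_has_caputo (H _) => [s _|s v _ _].
    by rewrite DyE upd_stack_t !stack_y.
  by rewrite upd_stack_t upd_stack_y; exact: UE.
- move=> i j t x y [t0 px /(_ j)[_ ax] _].
  have := @has_caputo_iterated_other _ _ _ halpha 0 U g (stack t x y) (x_index j)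
    (y_index i) (a 0 j) (x 0 j) (b 0 i) (sg 2%N).
  rewrite neq_xy => /(_ isT) H; apply: eq_has_caputo (H _) => [s _|s v sx _].
    by rewrite DyE upd_stack_x !stack_y.
  by rewrite upd_stack_x upd_stack_y; apply: UE; exact: ax.
- move=> i j t x y [t0 px _ _]; have [<-|ij] := eqVneq i j.
    have := @has_caputo_iterated_same _ _ _ halpha 0 U g (stack t x y) (y_index i)
      (b 0 i) (y 0 i) (sg 2%N).
    move=> H; apply: eq_has_caputo (H _) => [s _|s _].
      rewrite DyE stack_y upd_same; apply: (eq_caputo halpha) => v _.
      by rewrite -upd_stack_y upd_upd.
    by rewrite upd_stack_y; exact: UE.
  have := @has_caputo_iterated_other _ _ _ halpha 0 U g (stack t x y) (y_index j)
    (y_index i) (b 0 j) (y 0 j) (b 0 i) (sg 2%N).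
  rewrite eq_yy eq_sym ij => /(_ isT) H.
  apply: eq_has_caputo (H _) => [s _|s v _ _].
    by rewrite DyE upd_stack_y !stack_y upd_other.
  by rewrite !upd_stack_y; exact: UE.
Qed.

End smooth_regular.

(** A solution curve is only tested at admissible points, so pointwise equality
   there covers both clauses. *)
Lemma same_equations_ext (R : realType) (n : nat) (M : topologicalType) (alpha : R)
    (a b : 'rV[R]_n) (phi : chart R n M)
    (E E' : 'I_n -> R -> 'rV[R]_n -> 'rV[R]_n -> 'rV[R]_n -> R) :
  (forall i t x y y2, admissible a b phi t x y -> E i t x y y2 = E' i t x y y2) ->
  same_equations alpha a b phi E E'.
Proof.
move=> EE'; split=> // c T _ adm; split=> sol i t tT.
  by rewrite -EE' ?sol//; exact: adm.
by rewrite EE' ?sol//; exact: adm.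
Qed.

(** * The equations with a multiplier *)

Theorem proposition7 (R : realType) (alpha : R) (halpha : 0 < alpha < 1)
    (n : nat) (M : topologicalType) (A : set (chart R n M)) (hM : is_manifold A)
    (F : Osc A alpha -> R) (hF : smooth_jet (fun p : Jet A alpha => F p.2))
    (lam : R -> R) (hlam : forall t, 0 < t -> caputo_derivable alpha 0 lam t)
    (phi : chart R n M) (hphi : A phi) (a b : 'rV[R]_n) :
  let Dx := @Dx R n alpha a in
  let Dy := @Dy R n alpha b in
  let E := fun t : R => fun rho : R => mittag_leffler alpha (- rho * t `^ alpha) in
  let f := loc phi (fun p : Jet A alpha => F p.2) in
  (* Euler-Lagrange expressions of L2, with lambda = lambda(t) *)
  let EL_L2 := fun L : Jet A alpha -> R =>
    EL alpha a b (loc phi (fun p : Jet A alpha => L2 L F p.1 (lam p.1) p.2)) in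
  let eq_a := fun (L : Jet A alpha -> R) (i : 'I_n) (t : R) (x y y2 : 'rV[R]_n) =>
    let l := loc phi L in
    Dx i l t x y + lam t * Dx i f t x y
    - dt2 alpha a b (Dy i l) t x y y2
    - lam t * (\sum_j y 0 j * Dx j (Dy i f) t x y)
    - lam t * (\sum_j y2 0 j * Dy j (Dy i f) t x y)
    - caputo alpha 0 lam t * Dy i f t x y in
  let eq_b := fun (L1 : Osc A alpha -> R) (rho : R)
                  (i : 'I_n) (t : R) (x y y2 : 'rV[R]_n) =>
    let l1 := loc phi (fun p : Jet A alpha => L1 p.2) in
    E t rho *
      (Dx i l1 t x y + rho * Dy i l1 t x y
       - \sum_j y 0 j * Dx j (Dy i l1) t x y
       - \sum_j y2 0 j * Dy j (Dy i l1) t x y)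
    + lam t *
      (Dx i f t x y
       - \sum_j y 0 j * Dx j (Dy i f) t x y
       - \sum_j y2 0 j * Dy j (Dy i f) t x y)
    - caputo alpha 0 lam t * Dy i f t x y in
  (forall L : Jet A alpha -> R, smooth_jet L ->
     same_equations alpha a b phi (EL_L2 L) (eq_a L))
  /\
  (forall (rho : R) (L : Jet A alpha -> R) (L1 : Osc A alpha -> R),
     0 < rho ->
     smooth_jet (fun p : Jet A alpha => L1 p.2) ->
     (forall t u, 0 <= t -> L (t, u) = L1 u * E t rho) ->
     same_equations alpha a b phi (EL_L2 L) (eq_b L1 rho) /\
     same_equations alpha a b phi (eq_a L) (eq_b L1 rho)).
Proof.
move=> Dx Dy E f EL_L2 eq_a eq_b.
have rf : caputo_regular alpha a b phi f.
  exact: (smooth_regular a b halpha hphi hF).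
have fE t t' x y : f t x y = f t' x y by [].
have rlam t : 0 < t -> has_caputo alpha lam 0 t.
  by move=> /hlam; exact: caputo_derivable_has_caputo.
have rlf := regular_mul halpha rf fE rlam.
have partA (L : Jet A alpha -> R) i t x y y2 :
    caputo_regular alpha a b phi (loc phi L) -> admissible a b phi t x y ->
    EL_L2 L i t x y y2 = eq_a L i t x y y2.
  move=> rL h; have [t0 _ _ _] := h.
  have := EL_add halpha i y2 rL rlf h.
  rewrite (EL_mul halpha i y2 rf fE (rlam t t0) h) => H.
  exact: (etrans H (expression_multiplier _ _ _ _ _ _ _ _)).
split.
  move=> L sL; apply: same_equations_ext => i t x y y2 h.
  by apply: partA => //; exact: (smooth_regular a b halpha hphi sL).
move=> rho L L1 rho0 sL1 LE.
set l1 := loc phi (fun p : Jet A alpha => L1 p.2) in eq_b *.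
have rl1 : caputo_regular alpha a b phi l1.
  exact: (smooth_regular a b halpha hphi sL1).
have l1E t t' x y : l1 t x y = l1 t' x y by [].
have rE t : 0 < t -> has_caputo alpha (fun t => E t rho) 0 t.
  by move=> _; exact: has_caputo_mittag_leffler.
have rEl := regular_mul halpha rl1 l1E rE.
have lE t x y : 0 < t -> E t rho * l1 t x y = loc phi L t x y.
  by move=> t0; rewrite /loc LE ?ltW// mulrC.
have rL := eq_regular halpha lE rEl.
have partB i t x y y2 : admissible a b phi t x y ->
    eq_a L i t x y y2 = eq_b L1 rho i t x y y2.
  move=> h; have [t0 _ _ _] := h.
  have := eq_EL a b halpha i x y y2 lE t0.
  rewrite (EL_mul halpha i y2 rl1 l1E (rE t t0) h) caputo_mittag_leffler//.
  exact: expression_discount.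
split; apply: same_equations_ext => i t x y y2 h; last exact: partB.
by rewrite partA// partB.
Qed.
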